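(* Let $A$ be a finitely generated $RG$-module, and let $0\to M\to L\to A\to 0$ be an exact sequence of $RG$-modules, with $L$ free of finite rank. Then $$r_{R}(M)=r_{R}(L)-d_K(A_G)+ d_{R}(H_1(G,A)),$$ where $A_G=A/[A,G]$.
   Context: $p$ is a prime, $G$ is a finite $p$-group, and $R$ is the ring of integers of a finite extension $K$ of $\mathbb{Q}_p$, with uniformizing element $\pi$ and residue field $\overline{K}=R/(\pi)$. For an $RG$-module $A$, $[A,G]=\mathfrak{I}A$, where $\mathfrak{I}$ is the augmentation ideal of $RG$; thus $A_G=A/[A,G]$ is the module of coinvariants. For a finitely generated $R$-module $B$, $d_R(B)=\dim_{\overline{K}} B/\pi B$ and $d_K(B)=\dim_K (B\otimes_R K)$. For a finitely generated $RG$-module $A$, $r_R(A)=\dim_{\overline{K}} A/(\pi A+[A,G])$. $H_1(G,A)$ is the first homology group of $G$ with coefficients in $A$, viewed as an $R$-module. *)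

(* Defs.v *)
From HB Require Import structures.
From mathcomp Require Import all_boot all_order all_algebra all_fingroup all_solvable all_field.
From mathcomp Require Import ring_quotient.
From mathcomp Require Import zify boolp classical_sets.

Set Implicit Arguments.
Unset Strict Implicit.
Unset Printing Implicit Defensive.

Import GRing.Theory.
Local Open Scope ring_scope.
Local Open Scope quotient_scope.

Local Notation repr := generic_quotient.repr.

Section ClassicalUnits.
Variable R : comNzRingType.

Definition cunit : {pred R} := fun x => `[< exists y, y * x = 1 >].
Definition cinv (x : R) : R := xget x [set y | y * x = 1].

Lemma cunit_mulVx : {in cunit, left_inverse 1 cinv *%R}.
Proof. by move=> x /asboolP [y yx]; rewrite /cinv; case: xgetP => [z _ //|/(_ y)]. Qed.

Lemma cunitPl x y : y * x = 1 -> cunit x.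
Proof. by move=> yx; apply/asboolP; exists y. Qed.

Lemma cinv_out : {in [predC cunit], cinv =1 id}.
Proof.
move=> x /negP nx; rewrite /cinv; case: xgetP => // y _ yx.
by case: nx; apply: cunitPl yx.
Qed.
End ClassicalUnits.

Definition coherent (p : nat) : pred (nat -> nat) :=
  fun x => `[< forall n, x n = (x n.+1 %% p ^ n)%N >].

(* The p-adic integers, as the inverse limit of the Z/p^n: coherent sequences
   of representatives x n in [0, p^n).  The type carries the proof that p is
   prime, on which its ring structure depends. *)
Record padic_int (p : nat) (pp : prime p) :=
  PadicInt { padic_seq :> nat -> nat; _ : coherent p padic_seq }.

Section PadicIntegers.
Local Open Scope nat_scope.
Variables (p : nat) (pp : prime p).
Local Notation padic_int := (padic_int pp).
Local Notation coherent := (coherent p).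

HB.instance Definition _ := [isSub for @padic_seq p pp].
HB.instance Definition _ := [Choice of padic_int by <:].

Implicit Types x y z : padic_int.

Lemma zpP x n : val x n = (val x n.+1 %% p ^ n)%N.
Proof. by case: x => x /= /asboolP. Qed.

Lemma zp_mod x n : (val x n %% p ^ n)%N = val x n.
Proof. by rewrite zpP modn_mod. Qed.

Lemma zp_ext x y : (forall n, val x n = val y n %[mod p ^ n]) -> x = y.
Proof.
by move=> e; apply: val_inj; apply: functional_extensionality_dep => n;
  rewrite -[LHS]zp_mod -[RHS]zp_mod.
Qed.

Lemma zp_mod1 x n : val x n.+1 = val x n %[mod p ^ n].
Proof. by rewrite [in RHS]zpP modn_mod. Qed.

Fact zp_red_subproof (f : nat -> nat) :
  (forall n, f n.+1 = f n %[mod p ^ n]) -> coherent (fun n => f n %% p ^ n)%N.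
Proof.
move=> cf; apply/asboolP => n.
by rewrite modn_dvdm ?cf // dvdn_exp2l.
Qed.

Definition zp_red f (cf : forall n, f n.+1 = f n %[mod p ^ n]) : padic_int :=
  PadicInt pp (zp_red_subproof cf).

Fact zp_const_subproof (k n : nat) : k = k %[mod p ^ n].
Proof. by []. Qed.

Fact zp_add_subproof x y n :
  (val x n.+1 + val y n.+1 = val x n + val y n %[mod p ^ n])%N.
Proof. by rewrite -modnDm !zp_mod1 modnDm. Qed.

Fact zp_mul_subproof x y n :
  (val x n.+1 * val y n.+1 = val x n * val y n %[mod p ^ n])%N.
Proof. by rewrite -modnMm !zp_mod1 modnMm. Qed.

(* p ^ n - x n modulo p ^ n, without truncated subtraction *)
Fact zp_opp_subproof x n :
  ((p ^ n.+1).-1 * val x n.+1 = (p ^ n).-1 * val x n %[mod p ^ n])%N.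
Proof.
have pn m : (0 < p ^ m)%N by rewrite expn_gt0 prime_gt0.
apply/eqP; rewrite -(eqn_modDr (val x n.+1)); apply/eqP.
rewrite -mulSnr prednK //.
rewrite -[RHS]modnDmr zp_mod1 modnDmr -mulSnr prednK //.
by rewrite expnS -mulnA mulnCA !modnMr.
Qed.

Definition zp_zero := zp_red (zp_const_subproof 0).
Definition zp_one := zp_red (zp_const_subproof 1).
Definition zp_add x y := zp_red (zp_add_subproof x y).
Definition zp_opp x := zp_red (zp_opp_subproof x).
Definition zp_mul x y := zp_red (zp_mul_subproof x y).

Fact zp_addA : associative zp_add.
Proof. by move=> x y z; apply: zp_ext => n /=; rewrite !(modn_mod, modnDml, modnDmr) addnA. Qed.
Fact zp_addC : commutative zp_add.
Proof. by move=> x y; apply: zp_ext => n /=; rewrite addnC. Qed.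
Fact zp_add0 : left_id zp_zero zp_add.
Proof. by move=> x; apply: zp_ext => n /=; rewrite !(modn_mod, modnDml, modnDmr). Qed.
Fact zp_addN : left_inverse zp_zero zp_opp zp_add.
Proof.
move=> x; apply: zp_ext => n /=; rewrite !(modn_mod, modnDml, modnDmr) -mulSnr.
by rewrite prednK ?modnMr ?mod0n // expn_gt0 prime_gt0.
Qed.

HB.instance Definition _ :=
  GRing.isZmodule.Build padic_int zp_addA zp_addC zp_add0 zp_addN.

Fact zp_mulA : associative zp_mul.
Proof. by move=> x y z; apply: zp_ext => n /=; rewrite !(modn_mod, modnMml, modnMmr) mulnA. Qed.
Fact zp_mulC : commutative zp_mul.
Proof. by move=> x y; apply: zp_ext => n /=; rewrite mulnC. Qed.
Fact zp_mul1 : left_id zp_one zp_mul.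
Proof. by move=> x; apply: zp_ext => n /=; rewrite !(modn_mod, modnMml, modnMmr) mul1n. Qed.
Fact zp_mulDl : left_distributive zp_mul zp_add.
Proof.
move=> x y z; apply: zp_ext => n /=.
by rewrite !(modn_mod, modnMml, modnMmr, modnDml, modnDmr) mulnDl.
Qed.
Fact zp_one_neq0 : zp_one != zp_zero.
Proof.
apply/eqP => /(congr1 (fun x => val x 1%N)) /=.
by rewrite expn1 mod0n modn_small ?prime_gt1.
Qed.

HB.instance Definition _ := GRing.Zmodule_isComNzRing.Build padic_int
  zp_mulA zp_mulC zp_mul1 zp_mulDl zp_one_neq0.

HB.instance Definition _ := GRing.ComNzRing_hasMulInverse.Build padic_int
  (@cunit_mulVx padic_int) (@cunitPl padic_int) (@cinv_out padic_int).

Lemma zp_le x m n : (m <= n)%N -> val x n = val x m %[mod p ^ m].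
Proof.
move=> /subnK <-; elim: (n - m)%N => // k IH; rewrite addSn -IH.
have d : (p ^ m %| p ^ (k + m))%N by rewrite dvdn_exp2l // leq_addl.
by rewrite -(modn_dvdm _ d) zp_mod1 modn_dvdm.
Qed.

Lemma zp_neq0 x : x != 0%R ->
  exists2 m, 0 < m & forall n, m <= n -> ~~ (p ^ m %| val x n).
Proof.
move=> x0; apply: contrapT => H; case/eqP: x0; apply: zp_ext => m /=.
case: m => [|m]; first by rewrite !modn1.
rewrite modn_mod mod0n; apply: contrapT => xm; apply: H; exists m.+1 => // n mn.
by apply/negP; rewrite /dvdn zp_le // => /eqP.
Qed.

Fact zp_integral : GRing.integral_domain_axiom padic_int.
Proof.
move=> x y xy; case: (eqVneq x 0%R) => [//|x0]; case: (eqVneq y 0%R) => [//|y0].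
have [a a0 xa] := zp_neq0 x0; have [b b0 yb] := zp_neq0 y0.
have:= congr1 (fun z => val z (a + b)%N) xy.
rewrite /= mod0n; set u := val x _; set v := val y _ => uv.
have nu : ~~ (p ^ a %| u)%N by apply: xa; rewrite leq_addr.
have nv : ~~ (p ^ b %| v)%N by apply: yb; rewrite leq_addl.
have u0 : (0 < u)%N by case: (u) nu => //; rewrite dvdn0.
have v0 : (0 < v)%N by case: (v) nv => //; rewrite dvdn0.
move: uv nu nv => /eqP; rewrite -/(dvdn _ _) !pfactor_dvdn ?muln_gt0 ?u0 //.
rewrite lognM // -!ltnNge => h ha hb.
by move: h ha hb; lia.
Qed.

HB.instance Definition _ :=
  GRing.ComUnitRing_isIntegral.Build padic_int zp_integral.

Definition padic : Type := {fraction padic_int}.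
HB.instance Definition _ := GRing.Field.on padic.

End PadicIntegers.

(* The integral closure of the p-adic integers in a finite extension K of the
   p-adic numbers. *)
Section RingOfIntegers.
Variables (p : nat) (pp : prime p) (K : fieldExtType (padic pp)).

Definition padic_embed : padic_int pp -> K :=
  in_alg K \o (@tofrac (padic_int pp)).

HB.instance Definition _ := GRing.RMorphism.on padic_embed.

Definition integral_elt : {pred K} := fun x => `[< integralOver padic_embed x >].

Fact integral_elt_subring : subring_closed integral_elt.
Proof.
split=> [|x y /asboolP xi /asboolP yi|x y /asboolP xi /asboolP yi]; apply/asboolP.
- exact: integral1.
- exact: integral_sub.
- exact: integral_mul.
Qed.

Record integers := Integers { integers_elt : K; _ : integral_elt integers_elt }.

HB.instance Definition _ := [isSub for integers_elt].
HB.instance Definition _ := [Choice of integers by <:].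
HB.instance Definition _ := GRing.SubChoice_isSubComNzRing.Build K
  (fun x => integral_elt x) integers integral_elt_subring.
HB.instance Definition _ := GRing.ComNzRing_hasMulInverse.Build integers
  (@cunit_mulVx integers) (@cunitPl integers) (@cinv_out integers).

Fact integers_integral : GRing.integral_domain_axiom integers.
Proof.
move=> x y /(congr1 val); rewrite rmorphM rmorph0 => /eqP.
by rewrite mulf_eq0 -!(inj_eq val_inj) rmorph0.
Qed.

HB.instance Definition _ :=
  GRing.ComUnitRing_isIntegral.Build integers integers_integral.

Definition integers_val : {rmorphism integers -> K} := (val : integers -> K).

End RingOfIntegers.

Section Modules.
Variables (R : nzRingType) (V : lmodType R).

Definition is_basis n (b : 'I_n -> V) : Prop :=
  forall v, exists! c : 'rV[R]_n, v = \sum_i c 0 i *: b i.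

Definition free_of_finite_rank : Prop := exists n (b : 'I_n -> V), is_basis b.

Definition finitely_generated : Prop :=
  exists n (b : 'I_n -> V), forall v, exists c : 'rV[R]_n, v = \sum_i c 0 i *: b i.

Definition span (X : set V) : {pred V} := fun v =>
  `[< exists n (c : 'I_n -> R) (x : 'I_n -> V),
        (forall i, X (x i)) /\ v = \sum_i c i *: x i >].

Fact span_submod X : subsemimod_closed (span X).
Proof.
split; first split.
- by apply/asboolP; exists 0%N, (fun=> 0), (fun=> 0); rewrite big_ord0; split=> // -[].
- move=> _ _ /asboolP [n [c [x [xX ->]]]] /asboolP [m [d [y [yX ->]]]].
  apply/asboolP; exists (n + m)%N.
  exists (fun i => match split i with inl j => c j | inr j => d j end).
  exists (fun i => match split i with inl j => x j | inr j => y j end).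
  split=> [i|]; first by case: (split i).
  rewrite big_split_ord; congr (_ + _); apply: eq_bigr => i _.
    by case: splitP => [j /= /ord_inj -> //|k /= e]; have := ltn_ord i; lia.
  by case: splitP => [j /= e|k /= /addnI /ord_inj -> //]; have := ltn_ord j; lia.
- move=> a _ /asboolP [n [c [x [xX ->]]]]; apply/asboolP.
  exists n, (fun i => a * c i), x; split=> //.
  by rewrite scaler_sumr; apply: eq_bigr => i _; rewrite scalerA.
Qed.

HB.instance Definition _ X :=
  GRing.isSubmodClosed.Build R V (span X) (span_submod X).

Lemma span_gen (X : set V) x : X x -> x \in span X.
Proof.
move=> Xx; apply/asboolP; exists 1%N, (fun=> 1), (fun=> x).
by rewrite big_ord1 scale1r.
Qed.

Definition quotmod (X : set V) : Type := Quotient.quot (span X).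

HB.instance Definition _ X := GRing.Zmodule.on (quotmod X).

Variable X : set V.

Definition qpi : V -> quotmod X := \pi_(Quotient.quot (span X)).

Lemma qpi_eq u v : qpi u = qpi v <-> u - v \in span X.
Proof.
by rewrite Quotient.idealrBE; split=> [e|/eqP //]; apply/eqP.
Qed.

Lemma qpi_repr (x : quotmod X) : qpi (repr x) = x.
Proof. exact: reprK. Qed.

Lemma qpiD : {morph qpi : u v / u + v}.
Proof. by move=> u v; rewrite /qpi raddfD. Qed.

Definition quotmod_scale (a : R) (x : quotmod X) : quotmod X := qpi (a *: repr x).

Lemma qpiZ a u : quotmod_scale a (qpi u) = qpi (a *: u).
Proof.
by apply/qpi_eq; rewrite -scalerBr rpredZ //; apply/qpi_eq; rewrite qpi_repr.
Qed.

Fact quotmod_scalerA a b x :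
  quotmod_scale a (quotmod_scale b x) = quotmod_scale (a * b) x.
Proof. by rewrite -[x]qpi_repr !qpiZ scalerA. Qed.
Fact quotmod_scale1r : left_id 1 quotmod_scale.
Proof. by move=> x; rewrite -[x]qpi_repr !qpiZ scale1r. Qed.
Fact quotmod_scalerDr : right_distributive quotmod_scale +%R.
Proof.
by move=> a x y; rewrite -[x]qpi_repr -[y]qpi_repr -qpiD !qpiZ -qpiD scalerDr.
Qed.
Fact quotmod_scalerDl x : {morph quotmod_scale^~ x : a b / a + b}.
Proof. by move=> a b; rewrite -[x]qpi_repr !qpiZ -qpiD scalerDl. Qed.

HB.instance Definition _ := GRing.Zmodule_isLmodule.Build R (quotmod X)
  quotmod_scalerA quotmod_scale1r quotmod_scalerDr quotmod_scalerDl.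

End Modules.

(* Junk value 0 when V is not finite dimensional. *)
Definition dim (F : fieldType) (V : lmodType F) : nat :=
  xget 0%N [set n | exists b : 'I_n -> V, is_basis b]%classic.

(* B ⊗_R K, for R acting on K through f : R -> K: formal sums of pure tensors,
   modulo the congruence generated by the tensor relations. *)
Section ExtensionOfScalars.
Variables (R : comNzRingType) (K : fieldType) (f : {rmorphism R -> K}).
Variable B : lmodType R.

Inductive tensor_eq : seq (B * K) -> seq (B * K) -> Prop :=
| tensor_refl s : tensor_eq s s
| tensor_sym s t : tensor_eq s t -> tensor_eq t s
| tensor_trans s t u : tensor_eq s t -> tensor_eq t u -> tensor_eq s u
| tensor_cat s s' t t' :
    tensor_eq s s' -> tensor_eq t t' -> tensor_eq (s ++ t) (s' ++ t')
| tensor_comm s t : tensor_eq (s ++ t) (t ++ s)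
| tensor_zero k : tensor_eq [:: (0, k)] [::]
| tensor_addl b b' k : tensor_eq [:: (b + b', k)] [:: (b, k); (b', k)]
| tensor_addr b k k' : tensor_eq [:: (b, k + k')] [:: (b, k); (b, k')]
| tensor_bal r b k : tensor_eq [:: (r *: b, k)] [:: (b, f r * k)].

Definition tensor_rel : rel (seq (B * K)) := fun s t => `[< tensor_eq s t >].

Fact tensor_rel_equiv : equiv_class_of tensor_rel.
Proof.
split=> [s|s t|t s u]; first exact/asboolP/tensor_refl.
  by apply/asboolP/asboolP; apply: tensor_sym.
by move=> /asboolP st /asboolP tu; apply/asboolP; apply: tensor_trans tu.
Qed.

Canonical tensor_equiv := EquivRelPack tensor_rel_equiv.
Canonical tensor_encModRel := defaultEncModRel tensor_rel.

Definition tensor : Type := {eq_quot tensor_rel}.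
HB.instance Definition _ := Choice.on tensor.

Definition tpi : seq (B * K) -> tensor := \pi_{eq_quot tensor_rel}.

Lemma tpi_eq s t : tpi s = tpi t <-> tensor_eq s t.
Proof.
split=> [/eqmodP/asboolP //|st]; exact/eqmodP/asboolP.
Qed.

Lemma tpiK (x : tensor) : tpi (repr x) = x.
Proof. exact: reprK. Qed.

Lemma repr_tpi s : tensor_eq (repr (tpi s)) s.
Proof. by apply/tpi_eq; rewrite tpiK. Qed.

Definition tensor_opp_seq (s : seq (B * K)) := [seq (- x.1, x.2) | x <- s].
Definition tensor_scale_seq (a : K) (s : seq (B * K)) := [seq (x.1, a * x.2) | x <- s].

Lemma tensor_opp_eq s t :
  tensor_eq s t -> tensor_eq (tensor_opp_seq s) (tensor_opp_seq t).
Proof.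
elim=> {s t} /=.
- by move=> s; apply: tensor_refl.
- by move=> s t _; apply: tensor_sym.
- by move=> s t u _ st _; apply: tensor_trans.
- by move=> s s' t t' _ ss _ tt; rewrite /tensor_opp_seq !map_cat; apply: tensor_cat.
- by move=> s t; rewrite /tensor_opp_seq !map_cat; apply: tensor_comm.
- by move=> k; rewrite oppr0; apply: tensor_zero.
- by move=> b b' k; rewrite opprD; apply: tensor_addl.
- by move=> b k k'; apply: tensor_addr.
- by move=> r b k; rewrite -scalerN; apply: tensor_bal.
Qed.

Lemma tensor_scale_eq a s t :
  tensor_eq s t -> tensor_eq (tensor_scale_seq a s) (tensor_scale_seq a t).
Proof.
elim=> {s t} /=.
- by move=> s; apply: tensor_refl.
- by move=> s t _; apply: tensor_sym.
- by move=> s t u _ st _; apply: tensor_trans.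
- by move=> s s' t t' _ ss _ tt; rewrite /tensor_scale_seq !map_cat; apply: tensor_cat.
- by move=> s t; rewrite /tensor_scale_seq !map_cat; apply: tensor_comm.
- by move=> k; apply: tensor_zero.
- by move=> b b' k; apply: tensor_addl.
- by move=> b k k'; rewrite mulrDr; apply: tensor_addr.
- by move=> r b k; rewrite mulrCA; apply: tensor_bal.
Qed.

Definition tensor_zero_elt : tensor := tpi [::].
Definition tensor_add (x y : tensor) : tensor := tpi (repr x ++ repr y).
Definition tensor_opp (x : tensor) : tensor := tpi (tensor_opp_seq (repr x)).
Definition tensor_scale (a : K) (x : tensor) : tensor :=
  tpi (tensor_scale_seq a (repr x)).

Lemma tpiD s t : tensor_add (tpi s) (tpi t) = tpi (s ++ t).
Proof. by apply/tpi_eq; apply: tensor_cat; apply: repr_tpi. Qed.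
Lemma tpiN s : tensor_opp (tpi s) = tpi (tensor_opp_seq s).
Proof. by apply/tpi_eq; apply/tensor_opp_eq/repr_tpi. Qed.
Lemma tpiZ a s : tensor_scale a (tpi s) = tpi (tensor_scale_seq a s).
Proof. by apply/tpi_eq; apply/tensor_scale_eq/repr_tpi. Qed.

Fact tensor_addA : associative tensor_add.
Proof.
by move=> x y z; rewrite -[x]tpiK -[y]tpiK -[z]tpiK !tpiD catA.
Qed.
Fact tensor_addC : commutative tensor_add.
Proof.
move=> x y; rewrite -[x]tpiK -[y]tpiK !tpiD; apply/tpi_eq; exact: tensor_comm.
Qed.
Fact tensor_add0 : left_id tensor_zero_elt tensor_add.
Proof. by move=> x; rewrite -[x]tpiK !tpiD. Qed.
Fact tensor_addN : left_inverse tensor_zero_elt tensor_opp tensor_add.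
Proof.
move=> x; rewrite -[x]tpiK tpiN tpiD; apply/tpi_eq.
elim: (repr x) => [|[b k] s IH] /=; first exact: tensor_refl.
rewrite -cat1s -[(b, k) :: s]cat1s catA.
apply: (@tensor_trans _ (([:: (- b, k)] ++ [:: (b, k)]) ++ (tensor_opp_seq s ++ s))).
  rewrite -catA -[in X in tensor_eq _ X]catA; apply: tensor_cat; first exact: tensor_refl.
  rewrite !catA; apply: tensor_cat; last exact: tensor_refl.
  exact: tensor_comm.
rewrite -[X in tensor_eq _ X]cats0; apply: tensor_cat => //.
apply: tensor_trans (tensor_sym (tensor_addl _ _ _)) _.
by rewrite addNr; apply: tensor_zero.
Qed.

HB.instance Definition _ := GRing.isZmodule.Build tensor
  tensor_addA tensor_addC tensor_add0 tensor_addN.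

Fact tensor_scalerA a b x :
  tensor_scale a (tensor_scale b x) = tensor_scale (a * b) x.
Proof.
rewrite -[x]tpiK !tpiZ /tensor_scale_seq -map_comp; congr tpi.
by apply: eq_map => -[u v] /=; rewrite mulrA.
Qed.
Fact tensor_scale1r : left_id 1 tensor_scale.
Proof.
move=> x; rewrite -[x]tpiK !tpiZ; congr tpi; rewrite -[RHS]map_id.
by apply: eq_map => -[u v] /=; rewrite mul1r.
Qed.
Fact tensor_scalerDr : right_distributive tensor_scale +%R.
Proof.
move=> a x y; rewrite -[x]tpiK -[y]tpiK.
by rewrite [_ + _]tpiD !tpiZ [RHS]tpiD /tensor_scale_seq map_cat.
Qed.
Fact tensor_scalerDl x : {morph tensor_scale^~ x : a b / a + b}.
Proof.
move=> a b /=; rewrite -[x]tpiK !tpiZ [RHS]tpiD; apply/tpi_eq.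
elim: (repr x) => [|[u v] s IH] /=; first exact: tensor_refl.
rewrite -cat1s -[(u, a * v) :: _]cat1s -[(u, b * v) :: _]cat1s.
apply: (@tensor_trans _ (([:: (u, a * v)] ++ [:: (u, b * v)]) ++
   (tensor_scale_seq a s ++ tensor_scale_seq b s))).
  by apply: tensor_cat => //=; rewrite mulrDl; apply: tensor_addr.
rewrite -!catA; apply: tensor_cat; first exact: tensor_refl.
rewrite !catA; apply: tensor_cat; last exact: tensor_refl.
exact: tensor_comm.
Qed.

HB.instance Definition _ := GRing.Zmodule_isLmodule.Build K tensor
  tensor_scalerA tensor_scale1r tensor_scalerDr tensor_scalerDl.

End ExtensionOfScalars.

Section ResidueField.
Variable R : comUnitRingType.

(* pi generates the maximal ideal of R, i.e. its set of nonunits *)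
Definition uniformizer (pi : R) : Prop :=
  forall x, x \isn't a GRing.unit <-> exists y, x = pi * y.

Variables (pi : R) (pi_unif : uniformizer pi).

Definition multiples of uniformizer pi : {pred R} :=
  fun x => `[< exists y, x = pi * y >].

Fact multiples_ideal : idealr_closed (multiples pi_unif).
Proof.
split; first by apply/asboolP; exists 0; rewrite mulr0.
  by apply/asboolP => /pi_unif; rewrite unitr1.
move=> a _ _ /asboolP [x ->] /asboolP [y ->]; apply/asboolP.
by exists (a * x + y); rewrite mulrDr mulrCA.
Qed.

HB.instance Definition _ := isIdealr.Build R (multiples pi_unif) multiples_ideal.

Definition residue_field : Type := {ideal_quot (multiples pi_unif)}.

HB.instance Definition _ := GRing.ComNzRing.on residue_field.

Definition rpi : R -> residue_field := \pi_{ideal_quot (multiples pi_unif)}.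

Lemma rpi_eq u v : rpi u = rpi v <-> u - v \in multiples pi_unif.
Proof. by rewrite Quotient.idealrBE; split=> [e|/eqP //]; apply/eqP. Qed.

Lemma rpi_repr x : rpi (repr x) = x. Proof. exact: reprK. Qed.

Lemma rpi1 : rpi 1 = 1.
Proof. by rewrite /rpi rmorph1. Qed.
Lemma rpiD : {morph rpi : u v / u + v}.
Proof. by move=> u v; rewrite /rpi rmorphD. Qed.
Lemma rpiM : {morph rpi : u v / u * v}.
Proof. by move=> u v; rewrite /rpi rmorphM. Qed.

Definition residue_inv (x : residue_field) : residue_field :=
  if x == 0 then 0 else rpi (repr x)^-1.

Fact residue_mulVf x : x != 0 -> residue_inv x * x = 1.
Proof.
move=> x0; rewrite /residue_inv (negbTE x0) -{2}[x]rpi_repr -rpiM mulVr ?rpi1 //.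
apply: contraNT x0 => /pi_unif h; rewrite -[x]rpi_repr; apply/eqP.
rewrite -[RHS](_ : rpi 0 = _); last by rewrite /rpi rmorph0.
by apply/rpi_eq; rewrite subr0; apply/asboolP.
Qed.

Fact residue_inv0 : residue_inv 0 = 0.
Proof. by rewrite /residue_inv eqxx. Qed.

HB.instance Definition _ :=
  GRing.ComNzRing_isField.Build residue_field residue_mulVf residue_inv0.

Section ResidueModule.
Variables (V : lmodType R) (Vpi : forall v : V, pi *: v = 0).

Definition residue_module of uniformizer pi & (forall v : V, pi *: v = 0) : Type := V.
Local Notation VK := (residue_module pi_unif Vpi).

HB.instance Definition _ := GRing.Zmodule.copy VK V.

Definition residue_scale (a : residue_field) (v : VK) : VK := repr a *: (v : V).

Lemma rpiZ a v : residue_scale (rpi a) v = a *: (v : V).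
Proof.
apply/eqP; rewrite -subr_eq0 -scalerBl.
have /rpi_eq /asboolP [y ->] : rpi (repr (rpi a)) = rpi a by rewrite rpi_repr.
by rewrite mulrC -scalerA Vpi scaler0.
Qed.

Fact residue_scalerA a b v :
  residue_scale a (residue_scale b v) = residue_scale (a * b) v.
Proof. by rewrite -[a]rpi_repr -[b]rpi_repr -rpiM !rpiZ scalerA. Qed.
Fact residue_scale1r : left_id 1 residue_scale.
Proof. by move=> v; rewrite -rpi1 rpiZ scale1r. Qed.
Fact residue_scalerDr : right_distributive residue_scale +%R.
Proof. by move=> a u v; rewrite /residue_scale scalerDr. Qed.
Fact residue_scalerDl v : {morph residue_scale^~ v : a b / a + b}.
Proof. by move=> a b /=; rewrite -[a]rpi_repr -[b]rpi_repr -rpiD !rpiZ scalerDl. Qed.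

HB.instance Definition _ := GRing.Zmodule_isLmodule.Build residue_field VK
  residue_scalerA residue_scale1r residue_scalerDr residue_scalerDl.
End ResidueModule.

Definition pi_multiples (B : lmodType R) : set B := [set b | exists b', b = pi *: b']%classic.

Fact quotmod_killed (B : lmodType R) (X : set B) :
  (@pi_multiples B `<=` X)%classic -> forall v : quotmod X, pi *: v = 0.
Proof.
move=> BX v; rewrite -[v]qpi_repr [LHS]qpiZ -[RHS](raddf0 (\pi_(Quotient.quot (span X)))).
by apply/qpi_eq; rewrite subr0; apply/span_gen/BX; exists (repr v).
Qed.

Definition d_R (B : lmodType R) : nat :=
  dim (residue_module pi_unif (quotmod_killed (@subset_refl _ (@pi_multiples B)))).

End ResidueField.

Definition d_K (R : comNzRingType) (K : fieldType) (f : {rmorphism R -> K})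
  (B : lmodType R) : nat := dim (tensor f B).

(* Functions G -> R with the convolution product; x stands for the formal sum
   of the x g * g. *)
Definition group_ring (R : comNzRingType) (G : finGroupType) : Type := {ffun G -> R}.

Section GroupRing.
Variables (R : comNzRingType) (G : finGroupType).
Local Notation RG := (group_ring R G).

HB.instance Definition _ := GRing.Zmodule.copy RG {ffun G -> R}.

Definition gconst (r : R) : RG := [ffun h => if h == 1%g then r else 0].
Definition gelt (g : G) : RG := [ffun h => (h == g)%:R].
Definition gmul (x y : RG) : RG := [ffun g => \sum_h x h * y (h^-1 * g)%g].

Fact gmulA : associative gmul.
Proof.
move=> x y z; apply/ffunP => g; rewrite !ffunE.
under eq_bigr => h _ do rewrite ffunE mulr_sumr.
under [RHS]eq_bigr => k _ do rewrite ffunE mulr_suml.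
rewrite [RHS]exchange_big /=; apply: eq_bigr => h _.
rewrite [RHS](reindex_inj (mulgI h)) /=; apply: eq_bigr => k _.
by rewrite mulKg invMg mulgA mulrA.
Qed.
Fact gmul1l : left_id (gconst 1) gmul.
Proof.
move=> x; apply/ffunP => g; rewrite ffunE (bigD1 1%g) //= big1 => [|h h1].
  by rewrite ffunE eqxx mul1r invg1 mul1g addr0.
by rewrite ffunE (negbTE h1) mul0r.
Qed.
Fact gmul1r : right_id (gconst 1) gmul.
Proof.
move=> x; apply/ffunP => g; rewrite ffunE (bigD1 g) //= big1 => [|h hg].
  by rewrite ffunE mulVg eqxx mulr1 addr0.
by rewrite ffunE -eq_mulVg1 (negbTE hg) mulr0.
Qed.
Fact gmulDl : left_distributive gmul +%R.
Proof.
move=> x y z; apply/ffunP => g; rewrite !ffunE -big_split.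
by apply: eq_bigr => h _; rewrite ffunE mulrDl.
Qed.
Fact gmulDr : right_distributive gmul +%R.
Proof.
move=> x y z; apply/ffunP => g; rewrite !ffunE -big_split.
by apply: eq_bigr => h _; rewrite ffunE mulrDr.
Qed.
Fact gone_neq0 : gconst 1 != 0.
Proof. by apply/eqP => /ffunP/(_ 1%g)/eqP; rewrite !ffunE eqxx oner_eq0. Qed.

HB.instance Definition _ := GRing.Zmodule_isNzRing.Build RG
  gmulA gmul1l gmul1r gmulDl gmulDr gone_neq0.

Lemma gconst_mulE r (x : RG) g : (gconst r * x) g = r * x g.
Proof.
rewrite ffunE (bigD1 1%g) //= big1 => [|h h1].
  by rewrite ffunE eqxx invg1 mul1g addr0.
by rewrite ffunE (negbTE h1) mul0r.
Qed.
Lemma gconst_mulE' r (x : RG) g : (x * gconst r) g = r * x g.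
Proof.
rewrite ffunE (bigD1 g) //= big1 => [|h hg].
  by rewrite ffunE mulVg eqxx mulrC addr0.
by rewrite ffunE -eq_mulVg1 (negbTE hg) mulr0.
Qed.
Lemma gconst_comm r (x : RG) : x * gconst r = gconst r * x.
Proof. by apply/ffunP => g; rewrite gconst_mulE gconst_mulE'. Qed.

Definition augmentation (x : RG) : R := \sum_g x g.
Definition augmentation_ideal : set RG := [set x | augmentation x = 0]%classic.

Definition restr (A : lmodType RG) : Type := A.

Section Restr.
Variable A : lmodType RG.

HB.instance Definition _ := GRing.Zmodule.copy (restr A) A.

Definition restr_scale (r : R) (a : restr A) : restr A := gconst r *: (a : A).

Fact restr_scalerA r s a : restr_scale r (restr_scale s a) = restr_scale (r * s) a.
Proof.
rewrite /restr_scale scalerA; congr (_ *: _); apply/ffunP => g.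
by rewrite gconst_mulE !ffunE; case: ifP; rewrite ?mulr0.
Qed.
Fact restr_scale1r : left_id 1 restr_scale.
Proof. by move=> a; rewrite /restr_scale scale1r. Qed.
Fact restr_scalerDr : right_distributive restr_scale +%R.
Proof. by move=> r a b; rewrite /restr_scale scalerDr. Qed.
Fact restr_scalerDl a : {morph restr_scale^~ a : r s / r + s}.
Proof.
move=> r s; rewrite /restr_scale -scalerDl; congr (_ *: _); apply/ffunP => g.
by rewrite !ffunE; case: ifP; rewrite ?addr0.
Qed.

HB.instance Definition _ := GRing.Zmodule_isLmodule.Build R (restr A)
  restr_scalerA restr_scale1r restr_scalerDr restr_scalerDl.

Definition group_act (g : G) (a : restr A) : restr A := gelt g *: (a : A).

Fact group_act_linear g : linear (group_act g).
Proof.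
move=> r a b; rewrite /group_act scalerDr; congr (_ + _).
by rewrite [LHS]scalerA [RHS]scalerA gconst_comm.
Qed.
HB.instance Definition _ g :=
  GRing.isLinear.Build R (restr A) (restr A) _ (group_act g) (group_act_linear g).

(* Generators of [A, G]: the products x a with x in the augmentation ideal. *)
Definition commutator_gens : set (restr A) :=
  [set b | exists x : RG, exists2 a : A, augmentation_ideal x & b = x *: a]%classic.

Definition coinvariants : Type := quotmod commutator_gens.
HB.instance Definition _ := GRing.Lmodule.on coinvariants.

(* The inhomogeneous bar complex C_2 -> C_1 -> C_0 of G with coefficients in A,
   with C_n = A ⊗ Z[G^n] the module of functions G^n -> A, and A made into a
   right module by a g = g^-1 a. *)
Definition bar1 := {ffun G -> restr A}.
Definition bar2 := {ffun G * G -> restr A}.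

Definition single (g : G) (a : restr A) : bar1 := [ffun h => if h == g then a else 0].

Definition bar_d1 (c : bar1) : restr A := \sum_g (group_act g^-1%g (c g) - c g).
Definition bar_d2 (c : bar2) : bar1 :=
  \sum_gh (single gh.2 (group_act gh.1^-1%g (c gh)) - single (gh.1 * gh.2)%g (c gh)
           + single gh.1 (c gh)).

Definition cycle_pred : {pred bar1} := fun c => bar_d1 c == 0.

Fact cycle_submod : subsemimod_closed cycle_pred.
Proof.
split; first split.
- by apply/eqP; apply: big1 => g _; rewrite !ffunE raddf0 subrr.
- move=> c d /eqP cz /eqP dz; apply/eqP; rewrite -[RHS]addr0 -{1}cz -dz.
  rewrite /bar_d1 -big_split; apply: eq_bigr => g _.
  by rewrite ffunE raddfD opprD addrACA.
- move=> r c /eqP cz; apply/eqP; rewrite -(scaler0 _ r) -cz scaler_sumr.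
  by apply: eq_bigr => g _; rewrite ffunE linearZ scalerBr.
Qed.

Record cycles := Cycles { cycles_elt : bar1; _ : cycle_pred cycles_elt }.
HB.instance Definition _ := [isSub for cycles_elt].
HB.instance Definition _ := [Choice of cycles by <:].
HB.instance Definition _ := GRing.SubChoice_isSubLmodule.Build R bar1
  (fun c => cycle_pred c) cycles cycle_submod.

Definition boundaries : set cycles := [set z | exists c, val z = bar_d2 c]%classic.

Definition H1 : Type := quotmod boundaries.
HB.instance Definition _ := GRing.Lmodule.on H1.

End Restr.
End GroupRing.

Section Rank.
Variables (R : comUnitRingType) (pi : R) (pi_unif : uniformizer pi).
Variables (G : finGroupType) (A : lmodType (group_ring R G)).

Definition r_R_gens : set (restr A) :=
  (@pi_multiples R pi (restr A) `|` @commutator_gens R G A)%classic.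

Definition r_R : nat :=
  dim (residue_module pi_unif
    (quotmod_killed (@subsetUl _ (@pi_multiples R pi (restr A)) (@commutator_gens R G A)))).

End Rank.

(* Main.v *)
(* The homology sequence 0 -> H_1(G,A) -> M_G -> L_G -> A_G -> 0 is exact, as
   H_1(G,L) = 0 for L free.  Here L_G is free over R of rank n = r_R(L), so the
   image N of M_G is free over the discrete valuation ring R; tensoring with K,
   its rank is n - d_K(A_G).  Since N is projective, M_G = H_1(G,A) ⊕ N, and it
   remains to reduce modulo pi. *)

From HB Require Import structures.
Require Import Defs.
From mathcomp Require Import all_boot all_order all_algebra all_fingroup all_solvable all_field.
From mathcomp Require Import boolp classical_sets.

Set Implicit Arguments.
Unset Strict Implicit.
Unset Printing Implicit Defensive.

Import GRing.Theory.
Local Open Scope ring_scope.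

(** * The ring of integers is a discrete valuation ring *)

(** That R is a discrete valuation ring has to be proved: [uniformizer] only says that [pi]
    generates the nonunits of the integral closure, so it remains to show that no nonzero element is
    divisible by every power of [pi]. Monic equations over the p-adic integers settle this, without
    extending the valuation to K. The splitting of M_G is never constructed. A basis of N is lifted
    to M, minimal generators of H_1(G,A) modulo [pi] are represented by cycles and carried to M by
    the connecting homomorphism, and the joint family is shown directly to be a basis of M/(pi M +
    [M,G]). Working with chains and representatives turns each exactness statement into a lifting of
    elements. Smith normal form for submodules of R^n serves twice: its zero invariants count the
    rank of A_G and its nonzero ones that of N, and it gives the Noetherian property by which
    H_1(G,A) has a finite basis modulo [pi]. *)

Section PadicUnits.
Variables (p : nat) (pp : prime p).
Local Notation Zp := (padic_int pp).

(** Each residue [x n] is coprime to p^n, so Bezout coefficients invert it level by level;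
    uniqueness of inverses modulo p^n makes them coherent. *)
Lemma zp_unit (x : Zp) : ~~ (p %| val x 1)%N -> x \is a GRing.unit.
Proof.
move=> px.
have cop n : coprime (val x n) (p ^ n).
  case: n => [|n]; first by rewrite expn0 coprimen1.
  rewrite coprime_pexpr // coprime_sym prime_coprime //.
  apply: contra px; rewrite -[val x 1]zp_mod -(@zp_le _ _ x 1 n.+1) // expn1.
  by rewrite /dvdn modn_mod.
pose y n := (egcdn (val x n) (p ^ n)).1.
have xy n : (y n * val x n = 1 %[mod p ^ n])%N.
  (* [egcdnP] wants a positive argument; a zero residue is coprime to p^n only when p^n = 1. *)
  rewrite /y; case: (posnP (val x n)) => [e|x0].
    have := cop n; rewrite e /coprime gcd0n => /eqP ->.
    by rewrite !modn1.
  case: egcdnP => //= a b e _.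
  have := cop n; rewrite /coprime => /eqP g1; move: e; rewrite g1 => ->.
  by rewrite -modnDml modnMl.
have cy n : (y n.+1 = y n %[mod p ^ n])%N.
  have c : coprime (p ^ n) (val x n) by rewrite coprime_sym.
  have e : (val x n * y n.+1 = val x n * y n %[mod p ^ n])%N.
    rewrite [in RHS]mulnC xy mulnC -modnMmr -[(val x n %% _)%N]zp_mod1 modnMmr.
    have d : (p ^ n %| p ^ n.+1)%N by rewrite dvdn_exp2l.
    by rewrite -(modn_dvdm _ d) xy modn_dvdm.
  move/eqP: e; wlog le_y : / (y n <= y n.+1)%N => [hw e|].
    case/orP: (leq_total (y n) (y n.+1)) => [/hw/(_ e) //|le_y].
    apply/esym/eqP; rewrite eqn_mod_dvd // -(Gauss_dvdr _ c) mulnBr.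
    by rewrite -eqn_mod_dvd ?leq_mul // eq_sym.
  rewrite eqn_mod_dvd ?leq_mul // -mulnBr Gauss_dvdr // => e.
  by apply/eqP; rewrite eqn_mod_dvd.
apply/asboolP; exists (zp_red pp cy); apply: zp_ext => n /=.
by rewrite modnMml !modn_mod xy.
Qed.

Lemma zp_mulrn (x : Zp) k n : val (x *+ k) n = (k * val x n %% p ^ n)%N.
Proof.
elim: k => [|k IH]; first by rewrite mulr0n mul0n.
by rewrite mulrS /= IH modnDmr mulSn.
Qed.

(** Division by p costs one level of precision: the quotient modulo p^n is read off from x modulo
    p^(n+1). *)
Lemma zp_dvdp (x : Zp) : (p %| val x 1)%N -> exists y, x = p%:R * y.
Proof.
move=> px; have p0 := prime_gt0 pp.
have px' n : (p %| val x n.+1)%N.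
  by move: px; have := @zp_le _ _ x 1 n.+1 isT; rewrite expn1 /dvdn => ->.
pose y n := (val x n.+1 %/ p)%N.
have ey n : (val x n.+1 = p * y n)%N by rewrite /y mulnC divnK.
have cy n : (y n.+1 = y n %[mod p ^ n])%N.
  have := zp_mod1 x n.+1; rewrite !ey expnS -!muln_modr => /eqP.
  by rewrite eqn_pmul2l // => /eqP.
exists (zp_red pp cy); apply: zp_ext => n.
by rewrite mulr_natl zp_mulrn /= modnMmr !modn_mod -ey zp_mod1.
Qed.

Lemma zp_nunit (x : Zp) : x \isn't a GRing.unit -> exists y, x = p%:R * y.
Proof. by move=> xu; apply: zp_dvdp; apply: contraNT xu; apply: zp_unit. Qed.

Lemma zp_p_nunit : (p%:R : Zp) \isn't a GRing.unit.
Proof.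
apply/negP => /asboolP [y]; rewrite mulr_natr => /(congr1 (fun z => val z 1%N)).
by rewrite zp_mulrn expn1 modnMr /= modn_small // expn1 prime_gt1.
Qed.

Lemma zp_p_neq0 : (p%:R : Zp) != 0.
Proof.
have p1 := prime_gt1 pp; have p0 := ltnW p1.
(* Level 2 is needed, as p already vanishes at level 1. *)
apply/eqP => /(congr1 (fun z => val z 2)); rewrite zp_mulrn /= mod0n modnMmr muln1.
by rewrite modn_small ?ltn_Pmull // => e; rewrite e in p0.
Qed.

Lemma zp_pfactor (x : Zp) : x != 0 ->
  exists k, exists2 u, u \is a GRing.unit & x = p%:R ^+ k * u.
Proof.
case/zp_neq0 => m _ /(_ m (leqnn m)); elim: m x => [|m IH] x.
  by rewrite expn0 dvd1n.
move=> xm; have [xu|/zp_nunit [y xy]] := boolP (x \is a GRing.unit).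
  by exists 0%N, x; rewrite // mul1r.
have [|k [u uu yu]] := IH y; last by exists k.+1, u; rewrite // xy yu exprS mulrA.
apply: contra xm => ym; rewrite xy mulr_natl zp_mulrn /dvdn modn_mod expnS.
rewrite -muln_modr; have d : (p ^ m %| p ^ m.+1)%N by rewrite dvdn_exp2l.
by rewrite zp_mod1 (eqP ym) muln0.
Qed.

End PadicUnits.

(** * Integral elements over the p-adic integers, and valuations with respect to [pi] *)

Section IntegersAreDVR.
Variables (p : nat) (pp : prime p) (K : fieldExtType (padic pp)).
Local Notation Zp := (padic_int pp).
Local Notation OK := (integers K).

Fact padic_embed_integral (a : Zp) : integral_elt (@padic_embed _ pp K a).
Proof. exact/asboolP/integral_id. Qed.

Definition padic_to_integers (a : Zp) : OK := Integers (padic_embed_integral a).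

Fact padic_to_integers_zmod : zmod_morphism padic_to_integers.
Proof. by move=> a b; apply: val_inj; rewrite /= rmorphB. Qed.
Fact padic_to_integers_monoid : monoid_morphism padic_to_integers.
Proof. by split=> [|a b]; apply: val_inj; rewrite /= ?rmorph1 ?rmorphM. Qed.

HB.instance Definition _ :=
  GRing.isZmodMorphism.Build Zp OK padic_to_integers padic_to_integers_zmod.
HB.instance Definition _ :=
  GRing.isMonoidMorphism.Build Zp OK padic_to_integers padic_to_integers_monoid.

Local Notation emb := padic_to_integers.

Lemma padic_embed_inj : injective (@padic_embed _ pp K).
Proof. by move=> a b /fmorph_inj /eqP; rewrite tofrac_eq => /eqP. Qed.

Lemma padic_to_integers_inj : injective emb.
Proof. by move=> a b /(congr1 val) /padic_embed_inj. Qed.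

Lemma integers_root (x : OK) :
  exists2 q : {poly Zp}, q \is monic & (map_poly emb q).[x] = 0.
Proof.
case: (x) => y yi; case/asboolP: (yi) => q qm /rootP qy; exists q => //.
apply: val_inj; rewrite -[LHS](horner_map (integers_val K)) -map_poly_comp /=.
by rewrite -[RHS]qy.
Qed.

Lemma horner_padicMXaddC (q : {poly Zp}) c (y : OK) :
  (map_poly emb (q * 'X + c%:P)).[y] = (map_poly emb q).[y] * y + emb c.
Proof. by rewrite raddfD /= rmorphM /= map_polyX map_polyC !hornerE. Qed.

(** Clearing denominators in q(1/p): each term q_i p^(n-i) with i < n is a multiple of p in the
    p-adic integers, and only q_n survives modulo p. *)
Lemma horner_mul_pexp (y : OK) (q : {poly Zp}) n : y * p%:R = 1 ->
    (size q <= n.+1)%N ->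
  exists a, (map_poly emb q).[y] * p%:R ^+ n = emb (p%:R * a + q`_n).
Proof.
move=> yp; elim/poly_ind: q n => [|q c IH] n sq.
  by exists 0; rewrite map_poly0 horner0 mul0r mulr0 coef0 addr0 rmorph0.
have [q0|q0] := eqVneq q 0.
  rewrite q0 mul0r add0r map_polyC hornerC coefC.
  case: n {sq} => [|n]; first by exists 0; rewrite mulr1 mulr0 add0r.
  by exists (c * p%:R ^+ n); rewrite /= addr0 mulrCA -exprS rmorphM rmorphXn rmorph_nat.
case: n sq => [|n]; rewrite size_MXaddC (negPf q0) /= ltnS.
  by rewrite leqn0 size_poly_eq0 (negPf q0).
case/IH => a e; exists (a + c * p%:R ^+ n).
rewrite horner_padicMXaddC mulrDl.
rewrite exprS mulrA -[_ * y * _]mulrA yp mulr1 e coefD coefMX coefC /= addr0.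
by rewrite !(rmorphD, rmorphM, rmorphXn, rmorph_nat) mulrDr addrAC [p%:R * (_ * _)]mulrCA.
Qed.

(** An inverse of p would be a root of a monic q; clearing denominators gives p a + 1 = 0 in the
    p-adic integers, where p is not a unit. *)
Lemma integers_p_nunit : (p%:R : OK) \isn't a GRing.unit.
Proof.
apply/negP => /asboolP [y yp]; have [q qm qy] := integers_root y.
have sq : (0 < size q)%N by rewrite lt0n size_poly_eq0 monic_neq0.
have [|a] := @horner_mul_pexp y q (size q).-1 yp; first by rewrite prednK.
rewrite qy mul0r -lead_coefE (monicP qm) -(rmorph0 emb) => /padic_to_integers_inj/esym/eqP.
rewrite addr_eq0 => /eqP pa.
case/negP: (zp_p_nunit pp); apply/asboolP; exists (- a).
by rewrite mulNr mulrC pa opprK.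
Qed.

(** Once factors X are removed from an annihilating polynomial, its constant coefficient is a
    nonzero multiple of x. *)
Lemma integers_dvd_padic (x : OK) : x != 0 ->
  exists2 a, a != 0 & exists y, emb a = x * y.
Proof.
move=> x0; have [q /monic_neq0] := integers_root x.
elim/poly_ind: q => [|q c IH]; first by rewrite eqxx.
have [->|c0] := eqVneq c 0.
  rewrite horner_padicMXaddC [emb 0]rmorph0 !addr0 => q0 /eqP.
  rewrite mulf_eq0 (negPf x0) orbF => /eqP; apply: IH.
  by apply: contra q0 => /eqP ->; rewrite mul0r.
move=> _ e; exists c => //; exists (- (map_poly emb q).[x]).
move: e; rewrite horner_padicMXaddC => /eqP.
by rewrite addrC addr_eq0 mulrN mulrC => /eqP.
Qed.

Variables (pi : OK) (pi_unif : uniformizer pi).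

Definition inf_divisible (x : OK) := forall m, exists y, x = pi ^+ m * y.

Lemma nunit_pi x : x \isn't a GRing.unit -> exists y, x = pi * y.
Proof. by case: (pi_unif x) => + _; apply. Qed.

Lemma pi_nunit : pi \isn't a GRing.unit.
Proof. by apply/pi_unif; exists 1; rewrite mulr1. Qed.

Lemma pi_neq0 : pi != 0.
Proof.
apply/eqP => pi0; have [y e] := nunit_pi integers_p_nunit.
case/eqP: (zp_p_neq0 pp); apply: padic_to_integers_inj.
by rewrite [LHS]rmorph_nat [RHS]rmorph0 e pi0 mul0r.
Qed.

(* Applied to a monic annihilator of [pi], this shows that some power of [pi]
   does not divide [p]. *)
Lemma inf_divisible_coef_nunit (q : {poly Zp}) i :
  inf_divisible p%:R -> inf_divisible (map_poly emb q).[pi] ->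
  q`_i \isn't a GRing.unit.
Proof.
move=> pdiv; elim/poly_ind: q i => [|q c IH] i; first by rewrite coef0 unitr0.
rewrite horner_padicMXaddC => qdiv.
have cu : c \isn't a GRing.unit.
  have [y e] := qdiv 1%N; apply: contra pi_nunit => cu.
  have {}cu : emb c \is a GRing.unit := rmorph_unit emb cu.
  have : pi * (y - (map_poly emb q).[pi]) = emb c.
    by rewrite mulrBr -[pi * y]e [pi * _]mulrC addrAC subrr add0r.
  by move=> e'; rewrite -e' unitrM in cu; case/andP: cu.
case: i => [|i]; first by rewrite coefD coefMX coefC add0r.
rewrite coefD coefMX coefC /= addr0; apply: IH => m.
(* The constant coefficient is a multiple of p, hence itself infinitely divisible; subtracting it
   leaves pi times the value of q. The exponent is m+1 because one factor [pi] is then cancelled. *)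
have [z cz] := zp_nunit cu; have [y e] := qdiv m.+1; have [w pw] := pdiv m.+1.
exists (y - w * emb z); apply: (mulIf pi_neq0); move: e.
rewrite cz rmorphM rmorph_nat [X in _ + X * _]pw => /(canRL (addrK _)) ->.
by rewrite -[X in _ - X]mulrA -mulrBr exprSr -mulrA [pi * (_ - _)]mulrC mulrA.
Qed.

Lemma pi_factor x : ~ inf_divisible x -> exists v, exists2 u, u \is a GRing.unit & x = pi ^+ v * u.
Proof.
move=> /existsNP [m]; elim: m x => [|m IH] x xm; first by case: xm; exists x; rewrite mul1r.
have [xu|/nunit_pi [y xy]] := boolP (x \is a GRing.unit).
  by exists 0%N, x; rewrite // mul1r.
have [[z yz]|v [u uu yu]] := IH y; first by apply: xm; exists z; rewrite xy yz exprS mulrA.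
by exists v.+1, u; rewrite // xy yu exprS mulrA.
Qed.

(** The leading coefficient 1 of a monic annihilator of [pi] shows that p has a finite valuation e.
    A nonzero x divides some p^k u with u a unit, which bounds its valuation by e k. *)
Lemma integers_dvr (x : OK) : x != 0 ->
  exists v, exists2 u, u \is a GRing.unit & x = pi ^+ v * u.
Proof.
have pdiv : ~ inf_divisible p%:R.
  have [q qm q0] := integers_root pi => pdiv.
  have := @inf_divisible_coef_nunit q (size q).-1 pdiv.
  rewrite -lead_coefE (monicP qm) unitr1 q0 => /(_ _)/notF; apply => m.
  by exists 0; rewrite mulr0.
move=> x0; apply: pi_factor => xdiv.
have [e [w wu ew]] := pi_factor pdiv.
have [a a0 [y ay]] := integers_dvd_padic x0.
have [k [u uu eu]] := zp_pfactor a0.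
(* One more than the valuation e k of [emb a], so that [pi] would divide a unit. *)
have [z xz] := xdiv (e * k).+1.
have : pi * (z * y) = w ^+ k * emb u.
  apply: (@mulfI _ (pi ^+ (e * k))); first by rewrite expf_neq0 // pi_neq0.
  rewrite !mulrA -exprSr -xz -ay eu rmorphM rmorphXn rmorph_nat ew.
  by rewrite exprMn exprM.
move=> e'; have : w ^+ k * emb u \is a GRing.unit by rewrite unitrM unitrX // rmorph_unit.
by rewrite -e' unitrM (negPf pi_nunit).
Qed.

End IntegersAreDVR.

(** * Bases modulo a uniformizer and submodules of free modules *)

Definition submodule (R : nzRingType) (V : lmodType R) (S : V -> Prop) : Prop :=
  S 0 /\ forall a u v, S u -> S v -> S (a *: u + v).

Definition lincomb (R : nzRingType) (V : lmodType R) n (b : 'I_n -> V) (c : 'rV[R]_n) : V :=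
  \sum_i c 0 i *: b i.

Section LinearCombinations.
Variables (R : nzRingType) (V : lmodType R).
Implicit Types (S : V -> Prop).

Fact lincomb_linear n (b : 'I_n -> V) : linear (lincomb b).
Proof.
move=> a c d; rewrite /lincomb scaler_sumr -big_split; apply: eq_bigr => i _.
by rewrite !mxE scalerDl scalerA.
Qed.
HB.instance Definition _ n (b : 'I_n -> V) :=
  GRing.isLinear.Build R 'rV[R]_n V _ (lincomb b) (lincomb_linear b).

Lemma lincomb_mulmx m n (b : 'I_n -> V) (c : 'rV[R]_m) (P : 'M[R]_(m, n)) :
  lincomb b (c *m P) = lincomb (fun i => lincomb b (row i P)) c.
Proof.
rewrite /lincomb; under eq_bigr => j _ do rewrite mxE scaler_suml.
rewrite exchange_big; apply: eq_bigr => i _; rewrite scaler_sumr.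
by apply: eq_bigr => j _; rewrite mxE scalerA.
Qed.

Lemma lincomb_delta n (b : 'I_n -> V) i : lincomb b (delta_mx 0 i) = b i.
Proof.
rewrite /lincomb (bigD1 i) //= mxE !eqxx scale1r big1 ?addr0 // => j ji.
by rewrite mxE (negPf ji) andbF scale0r.
Qed.

Lemma linear_lincomb (W : lmodType R) (h : {linear V -> W}) n (b : 'I_n -> V) c :
  h (lincomb b c) = lincomb (h \o b) c.
Proof. by rewrite linear_sum; apply: eq_bigr => i _; rewrite linearZ. Qed.

Fact qpi_linear (X : set V) : linear (qpi X).
Proof. by move=> a u v; rewrite qpiD -qpiZ. Qed.
HB.instance Definition _ (X : set V) :=
  GRing.isLinear.Build R V (quotmod X) _ (qpi X) (qpi_linear X).

Lemma qpi_eq0 (X : set V) v : qpi X v = 0 <-> v \in Defs.span X.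
Proof. by rewrite -(raddf0 (qpi X)) qpi_eq subr0. Qed.

Lemma submoduleZ S a u : submodule S -> S u -> S (a *: u).
Proof. by case=> S0 SD Su; rewrite -[_ *: _]addr0; apply: SD. Qed.
Lemma submoduleD S u v : submodule S -> S u -> S v -> S (u + v).
Proof. by case=> S0 SD Su Sv; rewrite -[u]scale1r; apply: SD. Qed.
Lemma submoduleB S u v : submodule S -> S u -> S v -> S (u - v).
Proof. by case=> S0 SD Su Sv; rewrite addrC -scaleN1r; apply: SD. Qed.
Lemma submodule_sum S (I : Type) (r : seq I) (F : I -> V) :
  submodule S -> (forall i, S (F i)) -> S (\sum_(i <- r) F i).
Proof.
by move=> sS SF; elim/big_ind: _ => // [|u v]; [case: sS | apply: submoduleD].
Qed.

Lemma span_sub (X : set V) S : submodule S -> (forall x, X x -> S x) ->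
  forall v, v \in Defs.span X -> S v.
Proof.
move=> sS XS v /asboolP [n [c [x [xX ->]]]].
by apply: (submodule_sum _ sS) => i; apply: (submoduleZ _ sS); apply: XS.
Qed.

Lemma is_basisP n (b : 'I_n -> V) :
  is_basis b <-> (forall v, exists c, v = lincomb b c) /\
                 (forall c, lincomb b c = 0 -> c = 0).
Proof.
split=> [bb|[gen ind] v].
  split=> [v|c c0]; first by have [c [-> _]] := bb v; exists c.
  have [d [_ du]] := bb 0; rewrite -[LHS](du c) //; apply: du.
  by rewrite [RHS](raddf0 (lincomb b)).
have [c vc] := gen v; exists c; split=> // d vd.
apply/eqP; rewrite -subr_eq0; apply/eqP/ind.
by rewrite raddfB /= -[lincomb b c]vc -[lincomb b d]vd subrr.
Qed.

End LinearCombinations.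

Section Dimension.
Variables (F : fieldType) (V : lmodType F).

(** Expanding b in d and d in b gives matrices whose product is the identity of size m, and such a
    product cannot factor through a smaller size. *)
Lemma basis_size_le m n (b : 'I_m -> V) (d : 'I_n -> V) :
  is_basis b -> is_basis d -> (m <= n)%N.
Proof.
move=> /is_basisP [bg bi] /is_basisP [dg _].
have [A bA] := choice (fun i => dg (b i)); have [B dB] := choice (fun i => bg (d i)).
pose A' := \matrix_i A i; pose B' := \matrix_i B i.
apply: (@mulmx1_min _ _ _ A' B'); apply/row_matrixP => i; apply/eqP.
rewrite -subr_eq0; apply/eqP/bi; rewrite raddfB /= row_mul lincomb_mulmx rowK row1.
rewrite lincomb_delta [X in lincomb X](_ : _ = d) -?bA ?subrr //.
by apply/funext => j; rewrite rowK -dB.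
Qed.

Lemma dim_basis n (b : 'I_n -> V) : is_basis b -> Defs.dim V = n.
Proof.
move=> bb; rewrite /Defs.dim; case: xgetP => [m _ [d db]|/(_ n)]; last first.
  by case; exists b.
by apply/eqP; rewrite eqn_leq (basis_size_le bb db) (basis_size_le db bb).
Qed.

End Dimension.

(** * Bases over the residue field, expressed by elements of the module *)

Section ModuloUniformizer.
Variables (R : comUnitRingType) (pi : R) (pi_unif : uniformizer pi).
Variables (V : lmodType R) (X : set V).
Implicit Types n : nat.

Definition generates_mod n (b : 'I_n -> V) : Prop :=
  forall v, exists c, v - lincomb b c \in Defs.span X.

(** When pi V lies in X, this says that b reduces to a basis of V/span X over the residue field;
    independence becomes divisibility by [pi] of the coefficients of every relation. *)
Definition basis_mod n (b : 'I_n -> V) : Prop :=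
  generates_mod b /\ forall c, lincomb b c \in Defs.span X -> forall i, exists y, c 0 i = pi * y.

(** Both [d_R] and [r_R] are such dimensions, so this reduces the two ranks to statements about
    elements of V. *)
Lemma dim_residue_module (BX : (@pi_multiples R pi V `<=` X)%classic) n (b : 'I_n -> V) :
  basis_mod b -> Defs.dim (residue_module pi_unif (quotmod_killed BX)) = n.
Proof.
set W := residue_module _ _.
have qs (c : 'rV[R]_n) : lincomb (fun i => qpi X (b i) : W) (map_mx (rpi pi_unif) c)
    = qpi X (lincomb b c).
  rewrite linear_sum; apply: eq_bigr => i _.
  by rewrite mxE [LHS]rpiZ linearZ.
case=> gen ind; apply: (@dim_basis _ W n (fun i => qpi X (b i))).
apply/is_basisP; split=> [v|c].
  have [c vc] := gen (generic_quotient.repr (v : quotmod X)).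
  exists (map_mx (rpi pi_unif) c); rewrite qs.
  by rewrite -[LHS](qpi_repr v); apply/qpi_eq.
pose c' : 'rV[R]_n := map_mx (fun x => generic_quotient.repr x) c.
have -> : c = map_mx (rpi pi_unif) c' by apply/rowP => i; rewrite !mxE rpi_repr.
rewrite qs => /qpi_eq0/ind dvd; apply/rowP => i; rewrite mxE [RHS]mxE.
rewrite -[RHS](_ : rpi pi_unif 0 = _); last by rewrite /rpi rmorph0.
by apply/rpi_eq; rewrite subr0; apply/asboolP.
Qed.

Lemma basis_mod_exists n (b : 'I_n -> V) : generates_mod b ->
  exists m (d : 'I_m -> V), basis_mod d.
Proof.
move=> gb; pose gens m := `[< exists d : 'I_m -> V, generates_mod d >].
have ex : exists m, gens m by exists n; apply/asboolP; exists b.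
case: (ex_minnP ex) => m /asboolP [d gd] min; exists m, d; split=> // c cX i.
apply: contrapT => ci; have cu : c 0 i \is a GRing.unit.
  by apply: contra_notT ci => /pi_unif.
case: m d gd min c cX i ci cu => [|m] d gd min c cX i ci cu; first by case: i ci cu.
suff : gens m by move=> /min; rewrite ltnn.
apply/asboolP; exists (fun j => d (lift i j)) => v; have [e ve] := gd v.
(* Subtracting this multiple of the relation clears coordinate i without changing the class of v. *)
pose e' := e - (e 0 i / c 0 i) *: c.
have e'i : e' 0 i = 0 by rewrite !mxE divrK // subrr.
exists (\row_j e' 0 (lift i j)).
have -> : lincomb (fun j => d (lift i j)) (\row_j e' 0 (lift i j)) = lincomb d e'.
  rewrite [RHS](bigD1_ord i) //= e'i scale0r add0r.
  by apply: eq_bigr => j _; rewrite mxE.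
rewrite linearB linearZ /= opprB addrCA addrC.
by apply: rpredD => //; apply: rpredZ.
Qed.

End ModuloUniformizer.

(** * Smith normal form of a submodule of R^n *)

Section SmithForm.
Variable R : comUnitRingType.

(** One elimination step. As w starts with a unit and d0 divides all first coordinates in N, N is
    the sum of R d0 w and its vectors with first coordinate 0; w becomes the first row of the new
    basis, above the rows of P. *)
Lemma smith_pivot n (N : 'rV[R]_(1 + n) -> Prop) (w : 'rV[R]_(1 + n)) (d0 : R) :
    submodule N -> w 0 0 \is a GRing.unit -> N (d0 *: w) ->
    (forall u, N u -> exists c, u 0 0 = d0 * c) ->
    (exists (P : 'M[R]_n) (d : 'I_n -> R), P \in unitmx /\
      forall u, N (row_mx 0 (u *m P)) <-> forall i, exists c, u 0 i = d i * c) ->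
  exists (P : 'M[R]_(1 + n)) (d : 'I_(1 + n) -> R), P \in unitmx /\
      forall u, N (u *m P) <-> forall i, exists c, u 0 i = d i * c.
Proof.
move=> sN wu Nw div [P [d [Pu NP]]].
exists (block_mx (lsubmx w) (rsubmx w) 0 P).
exists (fun i => match split i with inl _ => d0 | inr j => d j end); split.
  rewrite unitmxE det_ublock unitrM -(unitmxE P) Pu andbT det_mx11 mxE.
  by rewrite [lshift _ _](_ : _ = 0) //; apply/val_inj.
move=> u; rewrite -{1}[u]hsubmxK [lsubmx u]mx11_scalar.
set c := lsubmx u 0 0; rewrite mul_row_block !mulmx0 addr0 !mul_scalar_mx.
have ec : c = u 0 (lshift n 0) by rewrite /c mxE.
have -> : row_mx (c *: lsubmx w) (c *: rsubmx w + rsubmx u *m P)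
    = c *: w + row_mx 0 (rsubmx u *m P).
  by rewrite -{3}[w]hsubmxK scale_row_mx add_row_mx addr0.
split=> [Nu|dvd].
  have [b cb] : exists b, c = d0 * b.
    have [b] := div _ Nu; rewrite 3!mxE; case: splitP => // j _; rewrite mxE addr0 => e.
    by exists (b / w 0 0); rewrite mulrA -e mulrK.
  have NuP : N (row_mx 0 (rsubmx u *m P)).
    rewrite -[row_mx _ _](addKr (c *: w)) addrC.
    by apply: submoduleB => //; rewrite cb mulrC -scalerA; apply: submoduleZ.
  move=> i; rewrite -[i]splitK; case: (split i) => j; rewrite unsplitK /=.
    by exists b; rewrite ord1 -ec.
  by move/NP: NuP => /(_ j) [y]; rewrite mxE => e; exists y.
apply: submoduleD => //.
  have := dvd (lshift n 0); rewrite -ec (unsplitK (inl _)) => -[b ->].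
  by rewrite mulrC -scalerA; apply: submoduleZ.
apply/NP => j; have := dvd (rshift 1 j); rewrite (unsplitK (inr _)) => -[b e].
by exists b; rewrite mxE.
Qed.

Variable pi : R.
Hypothesis dvr : forall x : R, x != 0 -> exists v, exists2 u, u \is a GRing.unit & x = pi ^+ v * u.

(* Coordinates adapted to a submodule: in the basis given by the rows of [P],
   [N] is the direct sum of the ideals generated by the [d i]. *)
Lemma smith_form n (N : 'rV[R]_n -> Prop) : submodule N ->
  exists (P : 'M[R]_n) (d : 'I_n -> R), P \in unitmx /\
      forall u, N (u *m P) <-> forall i, exists c, u 0 i = d i * c.
Proof.
elim: n N => [|n IH] N sN.
  exists 1%:M, (fun=> 0); rewrite unitmx1; split=> // u; split=> [_ []//|_].
  by rewrite [u *m _]thinmx0; apply sN.1.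
pose val_at k := `[< exists v i u, [/\ N v, u \is a GRing.unit & v 0 i = pi ^+ k * u] >].
have [ex|nex] := pselect (exists k, val_at k); last first.
  (* Here N is zero, since a nonzero entry would have a valuation; all invariants are 0. *)
  exists 1%:M, (fun=> 0); rewrite unitmx1; split=> // u; rewrite mulmx1; split.
    move=> Nu i; exists 0; rewrite mul0r; apply: contra_notP nex => /eqP/dvr.
    by case=> k [y yu e]; exists k; apply/asboolP; exists u, i, y.
  move=> u0; suff -> : u = 0 by apply sN.1.
  apply/rowP => i.
  by have [c ->] := u0 i; rewrite mul0r mxE.
(* The least valuation k of an entry of a vector in N: pi^k divides all entries and is the pivot. *)
case: (ex_minnP ex) => k /asboolP [v [i [y [Nv yu vi]]]] min.
have dvd u j : N u -> exists c, u 0 j = pi ^+ k * c.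
  move=> Nu; have [->|/dvr [l [z zu e]]] := eqVneq (u 0 j) 0; first by exists 0; rewrite mulr0.
  have /min kl : val_at l by apply/asboolP; exists u, j, z.
  by exists (pi ^+ (l - k) * z); rewrite mulrA -exprD subnKC.
have [q vq] := choice (fun j => dvd v j Nv).
have tK : tperm_mx 0 i *m tperm_mx 0 i = 1%:M :> 'M[R]_n.+1.
  by rewrite -perm_mxM tperm2 perm_mx1.
have col0 (u : 'rV[R]_n.+1) : (u *m tperm_mx 0 i) 0 0 = u 0 i.
  by rewrite -xcolE !mxE tpermL.
have coli (u : 'rV[R]_n.+1) : (u *m tperm_mx 0 i) 0 i = u 0 0.
  by rewrite -xcolE !mxE tpermR.
pose N1 (u : 'rV[R]_(1 + n)) := N (u *m tperm_mx 0 i).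
have sN1 : submodule N1.
  split=> [|a u w Nu Nw]; first by rewrite /N1 mul0mx; case: sN.
  by rewrite /N1 mulmxDl -scalemxAl; apply sN.2.
(* This is v divided by pi^k, with coordinates 0 and i swapped; entry i is y rather than [q i],
   because y is known to be a unit. *)
pose w : 'rV[R]_(1 + n) := \row_j (if j == i then y else q j) *m tperm_mx 0 i.
have ew : pi ^+ k *: w *m tperm_mx 0 i = v.
  rewrite -scalemxAl -mulmxA tK mulmx1; apply/rowP => j; rewrite !mxE.
  by case: eqP => [->|_]; rewrite -?vi -?vq.
have [||||P [d [Pu NP]]] := @smith_pivot n N1 w (pi ^+ k) sN1.
- by rewrite /w col0 mxE eqxx.
- by rewrite /N1 ew.
- by move=> u Nu; have := dvd _ i Nu; rewrite coli.
- apply: (IH (fun u => N1 (row_mx 0 u))); split.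
    by rewrite row_mx0; case: sN1.
  move=> a u u' Nu Nu'; rewrite -[0](addr0 0) -{1}[0](scaler0 _ a) -add_row_mx -scale_row_mx.
  by apply sN1.2.
exists (P *m tperm_mx 0 i), d; split.
  by rewrite unitmx_mul Pu; case: (mulmx1_unit tK).
by move=> u; rewrite mulmxA; apply: NP.
Qed.

(** S is pulled back to a submodule of R^n, where the rows of P scaled by the Smith invariants
    generate. *)
Lemma submodule_fin_gen (V : lmodType R) n (b : 'I_n -> V) (S : V -> Prop) :
    (forall v, exists c, v = lincomb b c) -> submodule S ->
  exists m (s : 'I_m -> V), (forall i, S (s i)) /\
    forall v, S v -> exists c, v = lincomb s c.
Proof.
move=> gen sS.
have [|P [d [Pu NP]]] := @smith_form n (fun c => S (lincomb b c)).
  split=> [|a c c' Sc Sc']; first by rewrite raddf0; case: sS.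
  by rewrite linearP; apply sS.2.
exists n, (fun i => lincomb b (d i *: row i P)); split=> [i|v Sv].
  rewrite rowE scalemxAl; apply/NP => j; exists (j == i)%:R.
  by rewrite !mxE eqxx; case: eqP => [->|_]; rewrite ?mulr0.
have [c vc] := gen v; have /NP dvd : S (lincomb b (c *m invmx P *m P)).
  by rewrite mulmxKV // -vc.
have [e ce] := choice dvd; exists (\row_i e i).
rewrite vc -[c](mulmxKV Pu) lincomb_mulmx; apply: eq_bigr => i _.
by rewrite linearZ /= scalerA mxE mulrC -ce.
Qed.
End SmithForm.

(** * The bar complex *)

Section GroupRingTheory.
Variables (R : comNzRingType) (G : finGroupType).
Local Notation RG := (group_ring R G).

Lemma gelt_mulE (h : G) (x : RG) g : (gelt R h * x) g = x (h^-1 * g)%g.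
Proof.
rewrite ffunE (bigD1 h) //= big1 => [|k kh]; first by rewrite ffunE eqxx mul1r addr0.
by rewrite ffunE (negPf kh) mul0r.
Qed.

Lemma geltM (g h : G) : gelt R g * gelt R h = gelt R (g * h)%g.
Proof.
by apply/ffunP => k; rewrite gelt_mulE !ffunE; congr (_%:R); rewrite -(inj_eq (mulgI g)) mulKVg.
Qed.

Lemma group_ring_sum (x : RG) : x = \sum_g gelt R g * gconst G (x g).
Proof.
apply/ffunP => h; rewrite sum_ffunE (bigD1 h) //= big1 => [|g gh].
  by rewrite gelt_mulE mulVg ffunE eqxx addr0.
by rewrite gelt_mulE ffunE -eq_mulVg1 (negPf gh).
Qed.

Fact augmentation_zmod : zmod_morphism (@augmentation R G).
Proof. by move=> x y; rewrite /augmentation -sumrB; apply: eq_bigr => g _; rewrite !ffunE. Qed.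
HB.instance Definition _ := GRing.isZmodMorphism.Build RG R (@augmentation R G) augmentation_zmod.

Local Notation aug := (@augmentation R G).

Lemma augmentationM (x y : RG) : aug (x * y) = aug x * aug y.
Proof.
rewrite /augmentation mulr_suml; under eq_bigr => g _ do rewrite ffunE.
rewrite exchange_big; apply: eq_bigr => h _; rewrite mulr_sumr.
by rewrite (reindex_inj (mulgI h)); apply: eq_bigr => k _; rewrite mulKg.
Qed.

Lemma augmentation_const r : aug (gconst G r) = r.
Proof.
rewrite /augmentation (bigD1 1%g) //= big1 ?addr0 ?ffunE ?eqxx // => g g1.
by rewrite ffunE (negPf g1).
Qed.

Lemma augmentation_gelt (g : G) : aug (gelt R g) = 1.
Proof.
rewrite /augmentation (bigD1 g) //= big1 ?addr0 ?ffunE ?eqxx // => h hg.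
by rewrite ffunE (negPf hg).
Qed.

Section BarComplex.
Variable A : lmodType RG.

Lemma group_actM g h (a : restr A) : group_act g (group_act h a) = group_act (g * h)%g a.
Proof. by rewrite /group_act scalerA geltM. Qed.

Lemma scale_sum_act (x : RG) (a : A) : x *: a = \sum_g group_act g (x g *: (a : restr A)).
Proof.
by rewrite {1}[x]group_ring_sum scaler_suml; apply: eq_bigr => g _; rewrite -scalerA.
Qed.

Fact bar_d1_linear : linear (@bar_d1 R G A).
Proof.
move=> r c d; rewrite /bar_d1 scaler_sumr -big_split; apply: eq_bigr => g _.
by rewrite !ffunE linearP /= scalerBr opprD addrACA.
Qed.
HB.instance Definition _ :=
  GRing.isLinear.Build R (bar1 A) (restr A) _ (@bar_d1 R G A) bar_d1_linear.

Fact single_linear g : linear (@single R G A g).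
Proof.
move=> r a b; apply/ffunP => h; rewrite !ffunE; case: ifP => // _.
by rewrite scaler0 addr0.
Qed.
HB.instance Definition _ g :=
  GRing.isLinear.Build R (restr A) (bar1 A) _ (@single R G A g) (single_linear g).

Fact bar_d2_linear : linear (@bar_d2 R G A).
Proof.
move=> r c d; rewrite /bar_d2 scaler_sumr -big_split; apply: eq_bigr => gh _.
rewrite !ffunE !linearP /= !scalerDr.
by rewrite [X in X + _ = _]addrACA [LHS]addrACA.
Qed.
HB.instance Definition _ :=
  GRing.isLinear.Build R (bar2 A) (bar1 A) _ (@bar_d2 R G A) bar_d2_linear.

Lemma bar_d1_single g (a : restr A) : bar_d1 (single g a) = group_act g^-1%g a - a.
Proof.
rewrite /bar_d1 (bigD1 g) //= big1 => [|h hg]; first by rewrite ffunE eqxx addr0.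
by rewrite ffunE (negPf hg) raddf0 subrr.
Qed.

Lemma bar_d1_d2 (c : bar2 A) : bar_d1 (bar_d2 c) = 0.
Proof.
rewrite /bar_d2 raddf_sum; apply: big1 => -[g h] _ /=.
rewrite raddfD raddfB /= !bar_d1_single group_actM invMg.
set x := group_act _ _; set y := group_act _ _.
by rewrite opprB [x - y + _]addrC [_ - x + _]addrA subrK addrA subrK subrr.
Qed.

Lemma single_sum (c : bar1 A) : c = \sum_g single g (c g).
Proof.
apply/ffunP => h; rewrite sum_ffunE (bigD1 h) //= big1 => [|g gh].
  by rewrite ffunE eqxx addr0.
by rewrite ffunE eq_sym (negPf gh).
Qed.

(** Identifies [A,G] with the image of [bar_d1], that is, A_G with H_0 of the bar complex. *)
Lemma span_commutator (a : restr A) :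
  a \in Defs.span (@commutator_gens R G A) <-> exists c, bar_d1 c = a.
Proof.
split.
  move: a; apply: span_sub.
    split=> [|r u v [c <-] [d <-]]; first by exists 0; rewrite raddf0.
    by exists (r *: c + d); rewrite linearP.
  (* [bar_d1] acts by g^-1, hence the coefficient at g^-1; the subtracted terms add up to the
     augmentation of x times a, which is 0. *)
  move=> _ [x [a x0 ->]]; exists [ffun g => x g^-1%g *: (a : restr A)].
  rewrite /bar_d1 sumrB (reindex_inj invg_inj) /=.
  under eq_bigr => g _ do rewrite ffunE !invgK.
  rewrite -scale_sum_act; under eq_bigr => g _ do rewrite ffunE.
  rewrite -scaler_suml (_ : \sum_g x g^-1%g = 0) ?scale0r ?subr0 //.
  by rewrite -[RHS]x0 [RHS](reindex_inj invg_inj).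
case=> c <-; apply: rpred_sum => g _; apply: span_gen.
exists (gelt R g^-1%g - 1), (c g); last by rewrite scalerBl scale1r.
by rewrite /augmentation_ideal /= raddfB /= augmentation_gelt augmentation_const subrr.
Qed.

Lemma span_boundaries (z : cycles A) :
  z \in Defs.span (@boundaries R G A) <-> exists c, val z = bar_d2 c.
Proof.
split; last exact: span_gen.
move: z; apply: span_sub => //.
split=> [|r u v [c uc] [d vd]]; first by exists 0; rewrite !raddf0.
by exists (r *: c + d); rewrite [RHS]linearP /= -[bar_d2 c]uc -[bar_d2 d]vd.
Qed.

End BarComplex.

Section Functoriality.
Variables (A B : lmodType RG) (f : {linear A -> B}).

Definition restr_map (a : restr A) : restr B := f a.

Fact restr_map_linear : linear restr_map.
Proof. by move=> r a b; rewrite /restr_map linearP. Qed.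
HB.instance Definition _ :=
  GRing.isLinear.Build R (restr A) (restr B) _ restr_map restr_map_linear.

Lemma restr_map_act g (a : restr A) : restr_map (group_act g a) = group_act g (restr_map a).
Proof. by rewrite /restr_map /group_act linearZ. Qed.

Definition bar1_map (c : bar1 A) : bar1 B := [ffun g => restr_map (c g)].
Definition bar2_map (c : bar2 A) : bar2 B := [ffun gh => restr_map (c gh)].

Fact bar1_map_linear : linear bar1_map.
Proof. by move=> r c d; apply/ffunP => g; rewrite !ffunE linearP. Qed.
HB.instance Definition _ :=
  GRing.isLinear.Build R (bar1 A) (bar1 B) _ bar1_map bar1_map_linear.

Lemma bar1_map_single g (a : restr A) : bar1_map (single g a) = single g (restr_map a).
Proof. by apply/ffunP => h; rewrite !ffunE; case: ifP => // _; rewrite raddf0. Qed.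

Lemma bar_d1_map c : bar_d1 (bar1_map c) = restr_map (bar_d1 c).
Proof.
rewrite raddf_sum; apply: eq_bigr => g _.
by rewrite raddfB /= restr_map_act ffunE.
Qed.

Lemma bar_d2_map c : bar_d2 (bar2_map c) = bar1_map (bar_d2 c).
Proof.
rewrite raddf_sum; apply: eq_bigr => gh _.
by rewrite raddfD raddfB /= !bar1_map_single restr_map_act ffunE.
Qed.

End Functoriality.

(** * Coinvariants and first homology of a free module *)

Section FreeModule.
Variables (L : lmodType RG) (n : nat) (b : 'I_n -> L).
Hypothesis bb : is_basis b.

Definition coords (l : L) : 'rV[RG]_n := projT1 (cid (((is_basisP b).1 bb).1 l)).

Lemma coordsK l : lincomb b (coords l) = l.
Proof. by rewrite /coords; case: cid. Qed.

Lemma lincomb_inj : injective (lincomb b).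
Proof.
move=> c d e; apply/eqP; rewrite -subr_eq0; apply/eqP/((is_basisP b).1 bb).2.
by rewrite raddfB /= e subrr.
Qed.

Lemma lincombK c : coords (lincomb b c) = c.
Proof. by apply: lincomb_inj; rewrite coordsK. Qed.

Fact coords_linear : linear coords.
Proof. by move=> x l m; apply: lincomb_inj; rewrite linearP /= !coordsK. Qed.
HB.instance Definition _ := GRing.isLinear.Build RG L 'rV[RG]_n _ coords coords_linear.

Lemma coordsZ x l : coords (x *: l) = x *: coords l.
Proof. exact: linearZ. Qed.

(** Induces the isomorphism of L_G with R^n: its kernel is [L,G], and it has the R-span of the basis
    as a section. *)
Definition aug_coords (l : restr L) : 'rV[R]_n := \row_i aug (coords l 0 i).

Fact aug_coords_linear : linear aug_coords.
Proof.
move=> r l m; apply/rowP => i; rewrite !mxE.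
rewrite [coords _](linearP coords) !mxE raddfD /= augmentationM augmentation_const.
by [].
Qed.
HB.instance Definition _ :=
  GRing.isLinear.Build R (restr L) 'rV[R]_n _ aug_coords aug_coords_linear.

Lemma aug_coords_lincomb c : aug_coords (lincomb (b : 'I_n -> restr L) c) = c.
Proof.
apply/rowP => i; rewrite mxE.
pose c' : 'rV[RG]_n := map_mx (@gconst R G) c.
have -> : lincomb (b : 'I_n -> restr L) c = lincomb b c'.
  by apply: eq_bigr => j _; rewrite mxE.
by rewrite lincombK mxE augmentation_const.
Qed.

Lemma aug_coords_eq0 (l : restr L) : aug_coords l = 0 <-> exists c, bar_d1 c = l.
Proof.
split=> [l0|[c <-]].
  apply/span_commutator; rewrite -[l]coordsK; apply: rpred_sum => i _.
  apply: span_gen; exists (coords l 0 i), (b i) => //.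
  by have := congr1 (fun v : 'rV_n => v 0 i) l0; rewrite !mxE.
rewrite [LHS]raddf_sum; apply: big1 => g _; rewrite raddfB /=; apply/eqP.
rewrite subr_eq0; apply/eqP/rowP => i; rewrite !mxE.
by rewrite [coords _]coordsZ mxE augmentationM augmentation_gelt mul1r.
Qed.

(* The component of [l] at the translate by [g^-1] of the R-span of the basis. *)
Definition component (g : G) (l : restr L) : restr L :=
  lincomb (b : 'I_n -> restr L) (\row_i coords l 0 i g^-1%g).

Fact component_linear g : linear (component g).
Proof.
move=> r l m; rewrite /component -linearP; congr lincomb; apply/rowP => i.
rewrite !mxE [coords _](linearP coords) !mxE ffunE.
by rewrite [X in X + _]gconst_mulE.
Qed.
HB.instance Definition _ g :=
  GRing.isLinear.Build R (restr L) (restr L) _ (component g) (component_linear g).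

Lemma component_act g h l : component g (group_act h^-1%g l) = component (g * h^-1)%g l.
Proof.
rewrite /component; congr lincomb; apply/rowP => i; rewrite !mxE.
by rewrite [coords _]coordsZ mxE gelt_mulE invgK invMg invgK.
Qed.

Lemma component_sum l : l = \sum_g group_act g^-1%g (component g l).
Proof.
rewrite -{1}[l]coordsK /lincomb; under eq_bigr => i _.
  rewrite [coords l 0 i]group_ring_sum scaler_suml (reindex_inj invg_inj) /=; over.
rewrite exchange_big; apply: eq_bigr => g _; rewrite /component /lincomb raddf_sum.
by apply: eq_bigr => i _; rewrite mxE -scalerA.
Qed.

(* Exactness at C_1 for a free module, by the contracting homotopy
   [e g ⊗ h |-> e ⊗ (g, h)]. *)
Lemma free_H1_eq0 (c : bar1 L) : bar_d1 c = 0 -> exists d, bar_d2 d = c.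
Proof.
move=> dc0; exists [ffun gh => component gh.1 (c gh.2)].
have -> : bar_d2 [ffun gh => component gh.1 (c gh.2)] =
    \sum_g \sum_h (single h (group_act g^-1%g (component g (c h)))
                   - single (g * h)%g (component g (c h)) + single g (component g (c h))).
  by rewrite pair_bigA; apply: eq_bigr => -[g h] _; rewrite ffunE.
under eq_bigr => g _ do rewrite big_split sumrB /=.
rewrite big_split sumrB /= -addrA.
have -> : \sum_g \sum_h single h (group_act g^-1%g (component g (c h))) = c.
  rewrite exchange_big [RHS]single_sum; apply: eq_bigr => h _.
  by rewrite -raddf_sum -component_sum.
have -> : \sum_g \sum_h single (g * h)%g (component g (c h))
    = \sum_g \sum_h single g (component (g * h^-1)%g (c h)).
  rewrite exchange_big [RHS]exchange_big; apply: eq_bigr => h _ /=.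
  rewrite [RHS](reindex_inj (mulIg h)); apply: eq_bigr => g _.
  by rewrite mulgK.
(* The two remaining sums combine to minus the sum of [single g (component g (bar_d1 c))], which
   vanishes because c is a cycle. *)
rewrite addrC -[RHS]add0r; congr (_ + _); rewrite addrC -sumrB; apply: big1 => g _.
rewrite -sumrB; have := congr1 (single g \o component g) dc0; rewrite /= !raddf0.
rewrite /bar_d1 (raddf_sum (component g)) (raddf_sum (single g)) /= => e.
rewrite -[RHS]oppr0 -[in RHS]e -sumrN.
apply: eq_bigr => h _.
by rewrite raddfB /= component_act raddfB opprB.
Qed.

End FreeModule.
End GroupRingTheory.

(** * Coinvariants and the rank formula *)

Section TensorDimension.
Variables (R : comNzRingType) (K : fieldType) (f : {rmorphism R -> K}).
Hypothesis f_inj : injective f.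
Variables (B : lmodType R) (m : nat) (phi : {linear B -> 'rV[R]_m}).

Definition ptensor (b : B) (k : K) : tensor f B := tpi f [:: (b, k)].

Lemma tpi_cat s t : tpi f (s ++ t) = tpi f s + tpi f t :> tensor f B.
Proof. by rewrite [RHS]tpiD. Qed.

Lemma tpi_sum s : tpi f s = \sum_(x <- s) ptensor x.1 x.2.
Proof.
elim: s => [|[b k] s IH]; first by rewrite big_nil.
by rewrite big_cons -IH -tpi_cat.
Qed.

Lemma ptensorDl b b' k : ptensor (b + b') k = ptensor b k + ptensor b' k.
Proof. by rewrite -tpi_cat; apply/tpi_eq/tensor_addl. Qed.
Lemma ptensor0l k : ptensor 0 k = 0.
Proof. by apply/tpi_eq/tensor_zero. Qed.
Lemma ptensorZl r b k : ptensor (r *: b) k = ptensor b (f r * k).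
Proof. by apply/tpi_eq/tensor_bal. Qed.
Lemma ptensorZ a b k : a *: ptensor b k = ptensor b (a * k).
Proof. by rewrite [LHS]tpiZ. Qed.

Lemma ptensor_torsion s b k : s != 0 -> s *: b = 0 -> ptensor b k = 0.
Proof.
move=> s0 sb; have fs : f s != 0 by rewrite -(rmorph0 f) (inj_eq f_inj).
by rewrite -[k](mulVKf fs) -ptensorZl sb ptensor0l.
Qed.

Lemma ptensor_lincomb n (e : 'I_n -> B) c k :
  ptensor (lincomb e c) k = \sum_i (f (c 0 i) * k) *: ptensor (e i) 1.
Proof.
rewrite /lincomb; elim/big_rec2: _ => [|i y x _ <-]; first exact: ptensor0l.
by rewrite ptensorDl ptensorZl ptensorZ mulr1.
Qed.

Definition tensor_eval (s : seq (B * K)) : 'rV[K]_m :=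
  \sum_(x <- s) x.2 *: map_mx f (phi x.1).

Lemma tensor_eval_eq s t : tensor_eq f s t -> tensor_eval s = tensor_eval t.
Proof.
rewrite /tensor_eval; elim=> {s t} //=.
- by move=> s t u _ -> _ ->.
- by move=> s s' t t' _ ss' _ tt'; rewrite !big_cat ss' tt'.
- by move=> s t; rewrite !big_cat /= addrC.
- by move=> k; rewrite big_nil big_seq1 /= raddf0 map_mx0 scaler0.
- by move=> b b' k; rewrite !big_cons !big_nil /= !addr0 raddfD map_mxD scalerDr.
- by move=> b k k'; rewrite !big_cons !big_nil /= !addr0 scalerDl.
- by move=> r b k; rewrite !big_seq1 /= linearZ /= map_mxZ scalerA mulrC.
Qed.

Definition tensor_coord (x : tensor f B) : 'rV[K]_m := tensor_eval (generic_quotient.repr x).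

Lemma tensor_coord_tpi s : tensor_coord (tpi f s) = tensor_eval s.
Proof. by apply: tensor_eval_eq; apply: repr_tpi. Qed.

Fact tensor_coord_linear : linear tensor_coord.
Proof.
move=> a x y; rewrite -[x]tpiK -[y]tpiK [a *: _]tpiZ -tpi_cat !tensor_coord_tpi.
rewrite /tensor_eval big_cat /= big_map scaler_sumr; congr (_ + _).
by apply: eq_bigr => i _; rewrite scalerA.
Qed.
HB.instance Definition _ :=
  GRing.isLinear.Build K (tensor f B) 'rV[K]_m _ tensor_coord tensor_coord_linear.

(** B is the sum of the free span of e and the torsion kernel of phi. Tensoring with K kills the
    torsion, and the map induced by phi on the tensor product detects independence. *)
Lemma d_K_free_mod_torsion (e : 'I_m -> B) :
    (forall c, phi (lincomb e c) = c) ->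
    (forall b, phi b = 0 -> exists2 s, s != 0 & s *: b = 0) ->
  d_K f B = m.
Proof.
move=> phie tors; apply: (@dim_basis _ _ m (fun i => ptensor (e i) 1)).
apply/is_basisP; split=> [x|c c0].
  rewrite -[x]tpiK tpi_sum.
  elim: (generic_quotient.repr x) => [|[b k] s [c IH]].
    by exists 0; rewrite big_nil raddf0.
  rewrite big_cons IH /=; exists (k *: map_mx f (phi b) + c).
  rewrite raddfD /=; congr (_ + _).
  have [s0 s00 sb] : exists2 s, s != 0 & s *: (b - lincomb e (phi b)) = 0.
    by apply: tors; rewrite raddfB /= phie subrr.
  rewrite -{1}[b](subrK (lincomb e (phi b))) ptensorDl (ptensor_torsion _ s00 sb) add0r.
  by rewrite ptensor_lincomb; apply: eq_bigr => i _; rewrite !mxE mulrC.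
have := congr1 tensor_coord c0; rewrite raddf0 linear_sum => <-.
have te i : tensor_coord (ptensor (e i) 1) = delta_mx 0 i.
  rewrite tensor_coord_tpi /tensor_eval big_seq1 scale1r /=.
  by rewrite -[e i](lincomb_delta e) phie map_delta_mx.
rewrite [LHS]row_sum_delta; apply: eq_bigr => i _.
by rewrite linearZ /= te.
Qed.

End TensorDimension.

Lemma linear_factor (R : nzRingType) (U V W : lmodType R)
    (q : {linear U -> W}) (h : {linear U -> V}) :
    (forall w, exists u, q u = w) -> (forall u, q u = 0 -> h u = 0) ->
  exists phi : {linear W -> V}, forall u, phi (q u) = h u.
Proof.
move=> q_surj qh; have [s qs] := choice q_surj.
have hs u : h (s (q u)) = h u.
  by apply/eqP; rewrite -subr_eq0 -raddfB; apply/eqP/qh; rewrite raddfB /= qs subrr.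
have phi_lin : linear (h \o s).
  by move=> a v w; rewrite -[v]qs -[w]qs -linearP /= !hs linearP.
pose phi : {linear W -> V} := HB.pack (h \o s) (GRing.isLinear.Build R W V _ (h \o s) phi_lin).
by exists phi => u; apply: hs.
Qed.

Lemma enum_val_setC (T : finType) (A : {set T}) i :
  i \notin A -> exists j : 'I_#|~: A|, enum_val j = i.
Proof.
move=> iA; have {}iA : i \in ~: A by rewrite inE.
by exists (enum_rank_in iA i); apply: enum_rankK_in.
Qed.

(** * Homology of 0 -> M -> L -> A -> 0 and the rank of M *)

Section Presentation.
Variables (R : idomainType) (pi : R) (pi_unif : uniformizer pi).
Hypothesis dvr : forall x : R, x != 0 ->
  exists v, exists2 u, u \is a GRing.unit & x = pi ^+ v * u.
Variables (G : finGroupType) (A M L : lmodType (group_ring R G)).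
Variables (f : {linear M -> L}) (g : {linear L -> A}).
Hypothesis f_inj : injective f.
Hypothesis g_surj : forall a : A, exists l : L, g l = a.
Hypothesis fg_exact : forall l : L, g l = 0 <-> exists m : M, f m = l.
Variables (n : nat) (b : 'I_n -> L).
Hypothesis bb : is_basis b.

Local Notation eps := (aug_coords bb).
Local Notation bR := (b : 'I_n -> restr L).

Lemma span_r_R_gens (B : lmodType (group_ring R G)) (v : restr B) :
  v \in Defs.span (@r_R_gens R pi G B) <-> exists u c, v = pi *: u + bar_d1 c.
Proof.
split.
  move: v; apply: span_sub.
    split; first by exists 0, 0; rewrite scaler0 raddf0 addr0.
    move=> r _ _ [u [c ->]] [u' [c' ->]]; exists (r *: u + u'), (r *: c + c').
    by rewrite [bar_d1 (_ + _)]linearP /= !scalerDr !scalerA [pi * r]mulrC addrACA.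
  move=> x [[u ->]|xc]; first by exists u, 0; rewrite raddf0 addr0.
  have /span_commutator [c <-] := span_gen xc.
  by exists 0, c; rewrite scaler0 add0r.
case=> u [c ->]; apply: rpredD; first by apply: span_gen; left; exists u.
have /asboolP [k [d [x [xc ->]]]] : bar_d1 c \in Defs.span (@commutator_gens R G B).
  by apply/span_commutator; exists c.
by apply: rpred_sum => i _; apply/rpredZ/span_gen; right.
Qed.

Lemma r_R_free : r_R pi_unif L = n.
Proof.
apply: (@dim_residue_module _ _ _ _ _ _ _ bR); split=> [l|c /span_r_R_gens [u [d e]] i].
  exists (eps l); apply/span_r_R_gens.
  have /aug_coords_eq0 [c e] : eps (l - lincomb bR (eps l)) = 0.
    by rewrite raddfB /= aug_coords_lincomb subrr.
  by exists 0, c; rewrite scaler0 add0r e.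
exists (eps u 0 i); have := congr1 eps e.
rewrite aug_coords_lincomb linearP /=.
have -> : eps (bar_d1 d) = 0 by apply/aug_coords_eq0; exists d.
by rewrite addr0 => ->; rewrite mxE.
Qed.

Lemma lift_bar1 (c : bar1 A) : exists l, bar1_map g l = c.
Proof.
have [s gs] := choice g_surj; exists [ffun h => (s (c h) : restr L)].
by apply/ffunP => h; rewrite !ffunE; apply: gs.
Qed.

Lemma lift_bar2 (c : bar2 A) : exists l, bar2_map g l = c.
Proof.
have [s gs] := choice g_surj; exists [ffun h => (s (c h) : restr L)].
by apply/ffunP => h; rewrite !ffunE; apply: gs.
Qed.

Lemma bar1_map_exact (c : bar1 L) : bar1_map g c = 0 -> exists d, bar1_map f d = c.
Proof.
move=> gc; have /choice [s fs] : forall h, exists m : M, f m = c h.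
  by move=> h; apply/fg_exact; have /ffunP/(_ h) := gc; rewrite !ffunE.
by exists [ffun h => (s h : restr M)]; apply/ffunP => h; rewrite !ffunE; apply: fs.
Qed.

(* The image of [M_G -> L_G], where [L_G] is identified with [R^n]. *)
Definition coinvariants_image (v : 'rV[R]_n) : Prop :=
  exists m : restr M, eps (restr_map f m) = v.

Lemma submodule_coinvariants_image : submodule coinvariants_image.
Proof.
split=> [|r _ _ [m <-] [m' <-]]; first by exists 0; rewrite !raddf0.
by exists (r *: m + m'); rewrite linearP /= linearP.
Qed.

Definition proj_coinvariants (l : restr L) : coinvariants A :=
  qpi (@commutator_gens R G A) (restr_map g l).

Fact proj_coinvariants_linear : linear proj_coinvariants.
Proof. by move=> r l m; rewrite /proj_coinvariants linearP /= linearP. Qed.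
HB.instance Definition _ :=
  GRing.isLinear.Build R (restr L) (coinvariants A) _ proj_coinvariants proj_coinvariants_linear.

Lemma proj_coinvariants_surj x : exists l, proj_coinvariants l = x.
Proof.
have [l gl] := g_surj (generic_quotient.repr x).
by exists l; rewrite -[RHS]qpi_repr -gl.
Qed.

(** Exactness of M_G -> L_G -> A_G in the middle: a chain of A with boundary g(l) lifts to L, and l
    minus the boundary of the lift comes from M. *)
Lemma proj_coinvariants_eq0 l :
  proj_coinvariants l = 0 <-> coinvariants_image (eps l).
Proof.
rewrite /proj_coinvariants qpi_eq0 span_commutator; split=> [[c gl]|[m ml]].
  have [d gd] := lift_bar1 c; rewrite -gd bar_d1_map in gl.
  have [m fm] : exists m, f m = l - bar_d1 d.
    by apply/fg_exact; rewrite raddfB; apply/eqP; rewrite subr_eq0; apply/eqP.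
  exists m; rewrite /restr_map fm raddfB /=.
  by rewrite (_ : eps (bar_d1 d) = 0) ?subr0 //; apply/aug_coords_eq0; exists d.
have /aug_coords_eq0 [c e] : eps (l - restr_map f m) = 0 by rewrite raddfB /= ml subrr.
exists (bar1_map g c); rewrite bar_d1_map e raddfB /=.
have -> : restr_map g (restr_map f m) = 0 by apply/fg_exact; exists m.
by rewrite subr0.
Qed.

(** In Smith coordinates A_G is the sum of the R/(d i): zero invariants give its rank, and the r
    nonzero ones give a basis of N, of which m is a lift to M. *)
Lemma coinvariants_rank (K : fieldType) (emb : {rmorphism R -> K}) : injective emb ->
  exists r (m : 'I_r -> restr M),
    [/\ (d_K emb (coinvariants A) + r = n)%N,
        forall x, exists c, eps (restr_map f (x - lincomb m c)) = 0
      & forall c, eps (restr_map f (lincomb m c)) = 0 -> c = 0].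
Proof.
move=> emb_inj.
have [P [d [Pu NP]]] := smith_form dvr submodule_coinvariants_image.
pose Z := [set i | d i == 0]%SET.
have dZ i : i \in Z -> d i = 0 by rewrite inE => /eqP.
pose h (l : restr L) : 'rV[R]_#|Z| := \row_j (eps l *m invmx P) 0 (enum_val j).
have h_lin : linear h.
  by move=> r l l'; apply/rowP => j; rewrite [LHS]mxE linearP /= mulmxDl -scalemxAl !mxE.
pose hL : {linear restr L -> 'rV[R]_#|Z|} :=
  HB.pack h (GRing.isLinear.Build R (restr L) 'rV[R]_#|Z| _ h h_lin).
have [phi phiE] : exists phi : {linear coinvariants A -> 'rV[R]_#|Z|},
    forall l, phi (proj_coinvariants l) = h l.
  apply: (@linear_factor _ _ _ _ proj_coinvariants hL proj_coinvariants_surj).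
  move=> l /proj_coinvariants_eq0; rewrite -[eps l](mulmxKV Pu) => /NP dvd.
  apply/rowP => j; rewrite [LHS]mxE [RHS]mxE; have [c ->] := dvd (enum_val j).
  by rewrite dZ ?mul0r ?enum_valP.
pose e (j : 'I_#|Z|) := proj_coinvariants (lincomb bR (row (enum_val j) P)).
have rowPV i : row i P *m invmx P = delta_mx 0 i by rewrite -row_mul mulmxV // row1.
have phie c : phi (lincomb e c) = c.
  rewrite linear_lincomb [RHS]row_sum_delta; apply: eq_bigr => j _; congr (_ *: _).
  apply/rowP => j'; rewrite /= phiE mxE aug_coords_lincomb rowPV !mxE eqxx.
  by rewrite (inj_eq enum_val_inj).
pose I := ~: Z; have dI i : i \in I -> d i != 0 by rewrite !inE.
have tors x : phi x = 0 -> exists2 s, s != 0 & s *: x = 0.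
  have [l <-] := proj_coinvariants_surj x; rewrite phiE => hl.
  (* The product of all nonzero invariants annihilates the torsion of A_G. *)
  exists (\prod_(i in I) d i); first by apply/prodf_neq0.
  rewrite -linearZ; apply/proj_coinvariants_eq0; rewrite -[eps _](mulmxKV Pu).
  apply/NP => i; rewrite linearZ /= -scalemxAl mxE.
  have [iZ|iI] := boolP (i \in Z); last first.
    have iI' : i \in I by rewrite finset.in_setC.
    by exists (\prod_(j in I | j != i) d j * (eps l *m invmx P) 0 i); rewrite (bigD1 i iI') mulrA.
  exists 0; have := congr1 (fun v : 'rV_#|Z| => v 0 (enum_rank_in iZ i)) hl.
  by rewrite mxE enum_rankK_in // => ->; rewrite !mxE !mulr0.
have /choice [m mE] : forall j : 'I_#|I|, exists m : restr M,
    eps (restr_map f m) = (d (enum_val j) *: delta_mx 0 (enum_val j)) *m P.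
  move=> j; apply/NP => i; rewrite !mxE eqxx; exists (i == enum_val j)%:R.
  by case: eqP => [->|]; rewrite ?mulr0.
pose w (c : 'rV[R]_#|I|) : 'rV[R]_n :=
  \sum_j c 0 j *: (d (enum_val j) *: delta_mx 0 (enum_val j)).
have mw c : eps (restr_map f (lincomb m c)) = w c *m P.
  rewrite !linear_lincomb /w mulmx_suml; apply: eq_bigr => j _.
  by rewrite -scalemxAl -mE.
have wI c j : w c 0 (enum_val j) = c 0 j * d (enum_val j).
  rewrite /w summxE (bigD1 j) //= !mxE !eqxx mulr1 big1 ?addr0 // => j' jj'.
  by rewrite !mxE eqxx (inj_eq enum_val_inj) eq_sym (negPf jj') !mulr0.
have wZ c i : i \in Z -> w c 0 i = 0.
  move=> iZ; rewrite /w summxE big1 // => j _; rewrite !mxE eqxx /=.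
  case: eqP => [ij|_]; last by rewrite !mulr0.
  by have := enum_valP j; rewrite -ij inE iZ.
exists #|I|, m; split.
- by rewrite (d_K_free_mod_torsion emb_inj phie tors) cardsC card_ord.
- move=> x; have : coinvariants_image (eps (restr_map f x)) by exists x.
  rewrite -[eps _](mulmxKV Pu) => /NP/choice [c xc].
  exists (\row_j c (enum_val j)); rewrite 2!raddfB /= mw -[eps _](mulmxKV Pu) -mulmxBl.
  rewrite [X in X *m P](_ : _ = 0) ?mul0mx //; apply/rowP => i.
  rewrite [LHS]mxE [X in _ + X]mxE xc [RHS]mxE; have [iZ|/enum_val_setC [j <-]] := boolP (i \in Z).
    by rewrite dZ // wZ // mul0r subrr.
  by rewrite wI mxE mulrC subrr.
move=> c; rewrite mw => /(congr1 (fun v => v *m invmx P)); rewrite mulmxK // mul0mx => w0.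
apply/rowP => j; have := wI c j; rewrite w0 !mxE => /esym/eqP.
by rewrite mulf_eq0 (negPf (dI _ (enum_valP j))) orbF => /eqP.
Qed.

(** Over R, the images of the basis of L must be taken with all their translates by G, and placed at
    every element of G. *)
Lemma bar1_fin_gen : exists k (s : 'I_k -> bar1 A), forall c, exists d, c = lincomb s d.
Proof.
pose s (t : G * G * 'I_n) : bar1 A := single t.1.1 (group_act t.1.2 (g (b t.2) : restr A)).
pose s' (j : 'I_#|{: G * G * 'I_n}|) := s (enum_val j).
exists #|{: G * G * 'I_n}|, s' => c.
have sS : submodule (fun c => exists d, c = lincomb s' d).
  split=> [|r _ _ [d ->] [d' ->]]; first by exists 0; rewrite raddf0.
  by exists (r *: d + d'); rewrite linearP.
have Ss t : exists d, s t = lincomb s' d.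
  by exists (delta_mx 0 (enum_rank t)); rewrite lincomb_delta /s' enum_rankK.
rewrite [c]single_sum; apply: (submodule_sum _ sS) => k.
have [l <-] := g_surj (c k); rewrite -[l](coordsK bb) linear_lincomb.
have -> : lincomb (g \o b) (coords bb l) =
    \sum_i \sum_h coords bb l 0 i h *: group_act h (g (b i) : restr A).
  apply: eq_bigr => i _; rewrite scale_sum_act; apply: eq_bigr => h _.
  by rewrite [LHS]linearZ.
rewrite linear_sum; apply: (submodule_sum _ sS) => i.
rewrite linear_sum; apply: (submodule_sum _ sS) => h.
by rewrite linearZ; apply: (submoduleZ _ sS); apply: (Ss (k, h, i)).
Qed.

Lemma bar_d1_cycle (z : cycles A) : bar_d1 (val z) = 0.
Proof. by case: z => c /= /eqP. Qed.

Lemma H1_fin_gen : exists k (z : 'I_k -> H1 A), forall v, exists c, v = lincomb z c.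
Proof.
have [k [s gs]] := bar1_fin_gen.
have [|m [z [zc gz]]] := submodule_fin_gen dvr (S := fun c => bar_d1 c = 0) gs.
  split=> [|r u v u0 v0]; first by rewrite raddf0.
  by rewrite linearP /= u0 v0 scaler0 addr0.
have zc' i : cycle_pred (z i) by apply/eqP.
exists m, (fun i => qpi (@boundaries R G A) (Cycles (zc' i))) => v.
have [c vc] := gz _ (bar_d1_cycle (generic_quotient.repr v)).
exists c; rewrite -[v]qpi_repr.
have -> : generic_quotient.repr v = lincomb (fun i => Cycles (zc' i)) c.
  by apply: val_inj; rewrite [LHS]vc [RHS]linear_lincomb.
exact: linear_lincomb.
Qed.

Lemma span_pi_multiples (V : lmodType R) (v : V) :
  v \in Defs.span (@pi_multiples R pi V) <-> exists u, v = pi *: u.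
Proof.
split; last by move=> e; apply: span_gen.
move: v; apply: span_sub => //.
split=> [|r _ _ [u ->] [u' ->]]; first by exists 0; rewrite scaler0.
by exists (r *: u + u'); rewrite scalerDr !scalerA mulrC.
Qed.

(** A basis of H_1(G,A) modulo [pi], restated for cycles modulo pi times cycles plus boundaries,
    since it is chains that can be lifted to L. *)
Lemma H1_basis_mod : exists k (z : 'I_k -> bar1 A),
  [/\ d_R pi_unif (H1 A) = k,
      forall i, bar_d1 (z i) = 0,
      forall y, bar_d1 y = 0 ->
        exists c y' d, bar_d1 y' = 0 /\ y = lincomb z c + pi *: y' + bar_d2 d
    & forall c y d, bar_d1 y = 0 -> lincomb z c = pi *: y + bar_d2 d ->
        forall i, exists x, c 0 i = pi * x].
Proof.
have [k0 [z0 gz0]] := H1_fin_gen.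
have [|k [z bz]] := @basis_mod_exists _ _ pi_unif _ (@pi_multiples R pi (H1 A)) _ z0.
  by move=> v; have [c ->] := gz0 v; exists c; rewrite subrr rpred0.
pose zc i : cycles A := generic_quotient.repr (z i).
have qz i : qpi (@boundaries R G A) (zc i) = z i := qpi_repr (z i).
have qlin c : qpi (@boundaries R G A) (lincomb zc c) = lincomb z c.
  by rewrite linear_lincomb; apply: eq_bigr => i _; rewrite /= qz.
have vlin c : val (lincomb zc c) = lincomb (fun i => val (zc i)) c.
  exact: (linear_lincomb (val : {linear cycles A -> bar1 A})).
exists k, (fun i => val (zc i)); split.
- exact: dim_residue_module bz.
- by move=> i; apply: bar_d1_cycle.
- move=> y y0; have cy : cycle_pred y by apply/eqP.
  have [c /span_pi_multiples [u e]] := bz.1 (qpi (@boundaries R G A) (Cycles cy)).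
  have /span_boundaries [d vd] : Cycles cy - lincomb zc c - pi *: generic_quotient.repr u
      \in Defs.span (@boundaries R G A).
    apply/qpi_eq0; rewrite 2!linearB /= qlin e linearZ /=. by rewrite scalerN subrr.
  exists c, (val (generic_quotient.repr u)), d; split; first exact: bar_d1_cycle.
  rewrite -vd 2!linearB /= vlin linearZ /=.
  by rewrite scalerN -(addrA y) -opprD [RHS]addrC subrK.
move=> c y d y0 e; have cy : cycle_pred y by apply/eqP.
apply: bz.2; apply/span_pi_multiples; exists (qpi (@boundaries R G A) (Cycles cy)).
rewrite -qlin -linearZ; apply/qpi_eq/span_boundaries; exists d.
by rewrite linearB /= vlin e ?scalerN [pi *: y + _]addrC addrK.
Qed.

(** The lifts m of a basis of N, together with the images [mz] of the cycles z under the connecting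
    homomorphism, form a basis of M modulo pi M + [M,G]. *)
Lemma r_R_kernel r (m : 'I_r -> restr M) :
  (forall x, exists c, eps (restr_map f (x - lincomb m c)) = 0) ->
  (forall c, eps (restr_map f (lincomb m c)) = 0 -> c = 0) ->
  r_R pi_unif M = (r + d_R pi_unif (H1 A))%N.
Proof.
move=> gen ind; have [k [z [-> z0 zgen zind]]] := H1_basis_mod.
have /choice [l lz] i := lift_bar1 (z i).
(* The connecting homomorphism: the boundary of a lift to L of a cycle of A comes from M. *)
have kerP y ly : bar1_map g ly = y -> bar_d1 y = 0 -> exists m : restr M, restr_map f m = bar_d1 ly.
  move=> gy y0; apply/fg_exact; rewrite -[LHS]/(restr_map g _) -bar_d1_map gy.
  exact: y0.
have /choice [mz fmz] i := kerP (z i) (l i) (lz i) (z0 i).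
have fR_inj : injective (restr_map f) by exact: f_inj.
have lin_l c : bar1_map g (lincomb l c) = lincomb z c.
  by rewrite linear_lincomb; apply: eq_bigr => i _; rewrite /= lz.
have lin_m c : restr_map f (lincomb mz c) = bar_d1 (lincomb l c).
  by rewrite !linear_lincomb; apply: eq_bigr => i _; rewrite /= fmz.
have eps_d1 c : eps (bar_d1 c) = 0 by apply/aug_coords_eq0; exists c.
pose t (i : 'I_(r + k)) := match split i with inl j => m j | inr j => mz j end.
have tE c : lincomb t c = lincomb m (lsubmx c) + lincomb mz (rsubmx c).
  rewrite /lincomb big_split_ord; congr (_ + _); apply: eq_bigr => i _.
    by rewrite mxE /t (unsplitK (inl _)).
  by rewrite mxE /t (unsplitK (inr _)).
apply: (@dim_residue_module _ _ _ _ _ _ _ t); split=> [x|c /span_r_R_gens [x [d e]]].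
  (* Generation: after subtracting its part along m, x dies in L_G, so its image is the boundary of
     a chain [lx] whose image in A is a cycle, to be expanded in z. *)
  have [c /aug_coords_eq0 [lx dlx]] := gen x.
  have gx0 : bar_d1 (bar1_map g lx) = 0.
    by rewrite bar_d1_map dlx; apply/fg_exact; exists (x - lincomb m c).
  have [c' [y [d [y0 ey]]]] := zgen _ gx0.
  have [ly gly] := lift_bar1 y; have [ld gld] := lift_bar2 d.
  have [my fmy] := kerP _ _ gly y0.
  (* This chain of L vanishes in A, hence comes from a chain [mu] of M, whose boundary is the error
     term in [M,G]. *)
  have [mu fmu] : exists mu, bar1_map f mu = lx - lincomb l c' - pi *: ly - bar_d2 ld.
    apply: bar1_map_exact; rewrite 3!linearB linearZ /= lin_l gly -bar_d2_map gld ey.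
    by rewrite -addrA -addrA -!opprD addrA subrr.
  exists (row_mx c c'); apply/span_r_R_gens; exists my, mu.
  rewrite tE row_mxKl row_mxKr opprD addrA; apply: fR_inj.
  rewrite linearB /= -dlx lin_m [RHS]linearP /= fmy -bar_d1_map fmu.
  rewrite 3!linearB /= linearZ /= bar_d1_d2 subr0.
  by rewrite [RHS]addrC subrK.
(* Independence: x is split along m. The part [x - lincomb m cx], the boundaries and the [mz] all
   die in L_G, so comparing images there gives [lsubmx c = pi *: cx]. *)
have [cx ex] := gen x.
have e2 : lincomb m (lsubmx c - pi *: cx)
    = pi *: (x - lincomb m cx) + bar_d1 d - lincomb mz (rsubmx c).
  rewrite linearB linearZ /= scalerBr; move: e; rewrite tE => /(canRL (addrK _)) ->.
  by rewrite [LHS]addrAC; congr (_ - _); rewrite addrAC.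
have ec : lsubmx c = pi *: cx.
  apply/eqP; rewrite -subr_eq0; apply/eqP/ind.
  rewrite e2 linearB linearP /= lin_m -bar_d1_map linearB linearP /= ex !eps_d1.
  by rewrite scaler0 add0r subrr.
have e3 : lincomb mz (rsubmx c) = pi *: (x - lincomb m cx) + bar_d1 d.
  by apply/eqP; rewrite eq_sym -subr_eq0 -e2 ec subrr raddf0.
have /aug_coords_eq0 [lx dlx] := ex.
have e1 : bar_d1 (lincomb l (rsubmx c) - pi *: lx - bar1_map f d) = 0.
  rewrite 2!linearB linearZ /= dlx bar_d1_map -lin_m e3 linearP /=.
  by rewrite -addrA -opprD subrr.
(* Injectivity of the connecting map: this cycle of L is a boundary, and its image in A is a
   relation among the z modulo [pi] and boundaries. *)
have [y ey] := free_H1_eq0 bb e1.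
have gf0 h : bar1_map g (bar1_map f h) = 0.
  by apply/ffunP => a; rewrite !ffunE; apply/fg_exact; exists (h a).
have gx0 : bar_d1 (bar1_map g lx) = 0.
  by rewrite bar_d1_map dlx; apply/fg_exact; exists (x - lincomb m cx).
have rz : lincomb z (rsubmx c) = pi *: bar1_map g lx + bar_d2 (bar2_map g y).
  by rewrite bar_d2_map ey 2!linearB linearZ /= lin_l gf0 subr0 [RHS]addrC subrK.
move=> i; rewrite -[i]splitK; case: (split i) => j /=.
  have := congr1 (fun v : 'rV_r => v 0 j) ec; rewrite !mxE => ->.
  by exists (cx 0 j).
by have [v vE] := zind _ _ _ gx0 rz j; exists v; rewrite -vE mxE.
Qed.

End Presentation.

Theorem theorem1p2 (p : nat) (pp : prime p) (K : fieldExtType (padic pp))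
    (pi : integers K) (pi_unif : uniformizer pi)
    (G : finGroupType) (pG : (p.-group [set: G])%g)
    (A M L : lmodType (group_ring (integers K) G))
    (fgA : finitely_generated A)
    (f : {linear M -> L}) (g : {linear L -> A})
    (f_inj : injective f) (g_surj : forall a : A, exists l : L, g l = a)
    (fg_exact : forall l : L, g l = 0 <-> exists m : M, f m = l)
    (freeL : free_of_finite_rank L) :
  (r_R pi_unif M)%:Z
    = (r_R pi_unif L)%:Z - (d_K (@integers_val p pp K) (coinvariants A))%:Z
      + (d_R pi_unif (H1 A))%:Z.
Proof.
have [n [b bb]] := freeL.
have dvr := integers_dvr pi_unif.
have emb_inj : injective (@integers_val p pp K) by exact: val_inj.
have [r [m [rank gen ind]]] := coinvariants_rank dvr g_surj fg_exact bb emb_inj.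
rewrite (r_R_kernel pi_unif dvr f_inj g_surj fg_exact gen ind) (r_R_free pi_unif bb).
by rewrite -rank !PoszD [X in _ = X + _]addrAC subrr add0r.
Qed.
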